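(* Let $\mathcal V$ be a finite-dimensional real vector space spanned by functions $f:[0,\infty)\to\mathbb R$, each definable in the same polynomially bounded o-minimal structure. Suppose that $\mathscr F\subseteq\mathcal V$ is a closed definable cone such that for all $f\in\mathscr F\setminus\{0\}$, $$\lim_{t\to\infty}f(t)\neq0 .$$ Then there exist $C>0$, $\alpha>0$ and $T_0\ge1$ such that every $f\in\mathscr F\setminus\{0\}$ is $(C,\alpha)$-good on $[T_0,\infty)$.
   Context: An o-minimal structure means an o-minimal structure on the ordered field of real numbers; it is polynomially bounded if for every definable $f:\mathbb R\to\mathbb R$ there is $r$ with $f(x)=O(x^r)$ as $x\to\infty$. Limits at $\infty$ of definable functions exist in $[-\infty,\infty]$. A subset $\mathscr F$ of a finite-dimensional real vector space $\mathcal V$ is a definable cone if it is a cone and is a definable set (in the given structure) after identifying $\mathcal V\cong\mathbb R^N$ by a choice of basis; closed refers to the usual topology of $\mathcal V$. For $C,\alpha>0$, a function $f:[0,\infty)\to\mathbb R$ is $(C,\alpha)$-good on $[T_0,\infty)$ if for every $\epsilon>0$ and every bounded interval $I\subseteq[T_0,\infty)$, $$|\{t\in I:|f(t)|\le\epsilon\}|\le C\left(\frac{\epsilon}{\|f\|_I}\right)^\alpha|I|,$$ where $|\cdot|$ is Lebesgue measure and $\|f\|_I=\sup_{t\in I}|f(t)|$. *)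

(* Defs.v *)
From HB Require Import structures.
From mathcomp Require Import all_boot all_order all_algebra.
From mathcomp Require Import all_classical all_reals all_analysis.
Set Implicit Arguments.
Unset Strict Implicit.
Unset Printing Implicit Defensive.
Import Order.TTheory GRing.Theory Num.Theory.
Import numFieldNormedType.Exports.
Local Open Scope classical_set_scope.
Local Open Scope ring_scope.

(* Expansions of the ordered field R in the sense of van den Dries:
   D n A means that A is a definable subset of R^n. *)
Record o_minimal_structure (R : realType) (D : forall n, set (set 'rV[R]_n)) :
    Prop := OMinimalStructure {
  om_set0 : forall n, D n set0 ;
  om_setU : forall n (A B : set 'rV[R]_n), D n A -> D n B -> D n (A `|` B) ;
  om_setC : forall n (A : set 'rV[R]_n), D n A -> D n (~` A) ;
  (* A * R and R * A *)
  om_cylr : forall n (A : set 'rV[R]_n), D n A ->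
    D (n + 1)%N [set x : 'rV[R]_(n + 1) | A (lsubmx x)] ;
  om_cyll : forall n (A : set 'rV[R]_n), D n A ->
    D (1 + n)%N [set x : 'rV[R]_(1 + n) | A (rsubmx x)] ;
  om_diag : forall n (i j : 'I_n), D n [set x : 'rV[R]_n | x 0 i = x 0 j] ;
  om_proj : forall n (A : set 'rV[R]_(n + 1)), D (n + 1)%N A ->
    D n [set lsubmx x | x in A] ;
  om_lt : D 2%N [set x : 'rV[R]_2 | x 0 0 < x 0 1] ;
  om_add : D 3%N [set x : 'rV[R]_3 | x 0 2 = x 0 0 + x 0 1] ;
  om_mul : D 3%N [set x : 'rV[R]_3 | x 0 2 = x 0 0 * x 0 1] ;
  (* o-minimality; `interval R` includes unbounded intervals and points *)
  om_line : forall A : set 'rV[R]_1, D 1%N A <->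
    exists s : seq (interval R),
      A = [set x : 'rV[R]_1 | exists2 i : interval R, i \in s & x 0 0 \in i]
}.

Definition definable_fun (R : realType) (D : forall n, set (set 'rV[R]_n))
    (A : set R) (f : R -> R) : Prop :=
  D 2%N [set x : 'rV[R]_2 | A (x 0 0) /\ x 0 1 = f (x 0 0)].

Definition polynomially_bounded (R : realType)
    (D : forall n, set (set 'rV[R]_n)) : Prop :=
  forall f : R -> R, definable_fun D setT f ->
    exists r k : R, \forall x \near +oo_R, `|f x| <= k * x `^ r.

(* Functions [0, +oo[ -> R; the codomain R^o makes them an lmodType R. *)
Notation halfline_fun R := ({nonneg R} -> R^o).

(* Value of f at a real number; only used at t >= 0, where |t| = t. *)
Definition at_real (R : realType) (f : halfline_fun R) (t : R) : R :=
  f (NngNum (normr_ge0 t)).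

Definition definable_halfline (R : realType) (D : forall n, set (set 'rV[R]_n))
    (f : halfline_fun R) : Prop :=
  definable_fun D `[0, +oo[ (at_real f).

Definition lincomb (R : realType) (E : lmodType R) (n : nat) (b : 'I_n -> E)
    (c : 'rV[R]_n) : E := \sum_i c 0 i *: b i.

Definition linear_span (R : realType) (E : lmodType R) (G : set E) : set E :=
  [set f | exists (n : nat) (g : 'I_n -> E) (c : 'rV[R]_n),
     (forall i, G (g i)) /\ f = lincomb g c].

Definition is_basis (R : realType) (E : lmodType R) (V : set E) (n : nat)
    (b : 'I_n -> E) : Prop :=
  (forall c, lincomb b c = 0 -> c = 0) /\ range (lincomb b) = V.

Definition finite_dimensional (R : realType) (E : lmodType R) (V : set E) :
    Prop :=
  exists (n : nat) (b : 'I_n -> E), is_basis V b.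

(* For definable_in and closed_in the choice of basis is immaterial: linear
   automorphisms of R^n are definable homeomorphisms. *)
Definition definable_in (R : realType) (D : forall n, set (set 'rV[R]_n))
    (E : lmodType R) (V F : set E) : Prop :=
  exists (n : nat) (b : 'I_n -> E), is_basis V b /\ D n (lincomb b @^-1` F).

Definition closed_in (R : realType) (E : lmodType R) (V F : set E) : Prop :=
  exists (n : nat) (b : 'I_n -> E),
    is_basis V b /\ closed (lincomb b @^-1` F : set 'rV[R]_n).

Definition cone (R : realType) (E : lmodType R) (F : set E) : Prop :=
  forall (a : R) (f : E), 0 < a -> F f -> F (a *: f).

Definition sup_norm (R : realType) (f : halfline_fun R) (I : set R) : \bar R :=
  ereal_sup [set `|at_real f t|%:E | t in I].

(* The right-hand side is computed in \bar R, where 0^-1 = +oo, +oo^-1 = 0 and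
   x * 0 = 0; for empty I both sides are 0. *)
Definition good (R : realType) (C alpha T0 : R) (f : halfline_fun R) : Prop :=
  forall (eps : R) (I : set R), 0 < eps ->
    is_interval I -> bounded_set I -> I `<=` `[T0, +oo[ ->
    (lebesgue_measure [set t | I t /\ (`|at_real f t| <= eps)%R]
     <= C%:E * poweR (eps%:E / sup_norm f I) alpha * lebesgue_measure I)%E.

(* Main.v *)
(* Germs at infinity of definable functions are closed under derivation, and
   polynomial boundedness makes t h'(t) / h(t) bounded for a nonzero germ h, and
   bounded away from 0 when h tends to 0 or to infinity (otherwise h or 1/h, or
   the inverse function of h, would grow faster than every power). Hence V is
   spanned near infinity by functions e_1, e_2, ... with e_{j+1} = o(e_j).

   For f = sum_j c_j e_j, dividing by e_1 and differentiating removes one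
   function. Induction on the number of functions yields: f is piecewise
   monotone with a bounded number of pieces; for intervals J in I in [T, 2T],
   sup_I |f| <= C (|I|/|J|)^N sup_J |f|; and |c_j e_j(T)| <= C sup_[T,2T] |f|. On
   a closed cone whose nonzero elements do not tend to 0, compactness bounds all
   the coefficients by those of the e_j that do not tend to 0; such e_j are
   essentially nondecreasing, which extends the second inequality to all
   intervals J in I in [T0, +oo[. Applied to the at most 2^n intervals composing
   {t in I : |f(t)| <= eps}, it says that f is (C, 1/N)-good. *)
Require Import Defs.
From mathcomp Require Import all_boot all_order all_algebra.
From mathcomp Require Import all_classical all_reals all_analysis.
From mathcomp Require Import ring lra.
Import Order.TTheory GRing.Theory Num.Theory.
Import numFieldNormedType.Exports.
Local Open Scope classical_set_scope.
Local Open Scope ring_scope.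
Set Implicit Arguments.
Unset Strict Implicit.

(** * First-order definability *)

(** Decay is the obstacle. For f = 1/t on [T0, L], the set where |f| <= 2/L is about half of the
    interval, while (2/L) / sup |f| = 2 T0 / L is arbitrarily small. So functions tending to 0
    cannot be good on a half-line, and a + b/t with a small against b is as bad: closedness is what
    turns the hypothesis on limits into a uniform one. The intervals [T, 2T] are those on which a
    definable function varies by a bounded factor only, so that dividing by e_1 and multiplying back
    costs a constant. A bound on g = f / e_1 over an interval says nothing about g' on all of it;
    but g' is monotone on a large piece, and on the middle third of that piece the mean value
    theorem bounds it. The inequality for g' then recovers the whole interval. Regularity near
    infinity uses only the shape of definable subsets of the line: irregularity at all large t would
    be covered by countably many definable conditions, one of which would hold on an interval, where
    it is absurd. *)

(* First-order formulas are predicates on valuations [nat -> R]; [pad] extends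
   a row vector by zeros. *)
Definition pad (R : realType) n (x : 'rV[R]_n) (i : nat) : R :=
  if insub i is Some j then x 0 j else 0.

(** Valuations are infinite, so that variables can be shifted and renamed without tracking arities.
    A bound on the variables that matter is what makes evaluation at a padded row faithful. *)
Definition supported (R : realType) n (P : (nat -> R) -> Prop) : Prop :=
  forall e e', (forall i, (i < n)%N -> e i = e' i) -> P e -> P e'.

Definition dfn_at (R : realType) (D : forall n : nat, set (set 'rV[R]_n))
    n (P : (nat -> R) -> Prop) : Prop :=
  supported n P /\ D n [set x | P (pad x)].

Definition dfn (R : realType) (D : forall n : nat, set (set 'rV[R]_n))
    (P : (nat -> R) -> Prop) : Prop := exists n, dfn_at D n P.

(* In the graph of [t] the variable 0 is the value of [t], and the arguments of
   [t] are shifted by one. *)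
Definition dterm (R : realType) (D : forall n : nat, set (set 'rV[R]_n))
    (t : (nat -> R) -> R) : Prop :=
  dfn D (fun e => e 0%N = t (fun i => e i.+1)).

Definition definable1 (R : realType) (D : forall n : nat, set (set 'rV[R]_n))
    (f : R -> R) : Prop := dterm D (fun e => f (e 0%N)).

Definition definable2 (R : realType) (D : forall n : nat, set (set 'rV[R]_n))
    (f : R -> R -> R) : Prop := dterm D (fun e => f (e 0%N) (e 1%N)).

Definition dset (R : realType) (D : forall n : nat, set (set 'rV[R]_n))
    (A : set R) : Prop := dfn D (fun e => A (e 0%N)).

Definition right_of_0 (R : realType) (P : R -> Prop) : Prop :=
  exists d : R, 0 < d /\ forall h : R, 0 < h -> h < d -> P h.

Lemma padE (R : realType) n (x : 'rV[R]_n) (j : 'I_n) : pad x j = x 0 j.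
Proof. by rewrite /pad valK. Qed.

Lemma pad_lsubmx (R : realType) n m (x : 'rV[R]_(n + m)) i : (i < n)%N ->
  pad (lsubmx x) i = pad x i.
Proof.
move=> lt_in; rewrite (padE _ (Ordinal lt_in)) mxE.
by rewrite -(padE x (lshift m _)).
Qed.

Lemma pad_rsubmx (R : realType) n m (x : 'rV[R]_(n + m)) i : (i < m)%N ->
  pad (rsubmx x) i = pad x (n + i)%N.
Proof.
move=> lt_in; rewrite (padE _ (Ordinal lt_in)) mxE.
by rewrite -(padE x (rshift n _)).
Qed.

Lemma pad_row_mx (R : realType) n (x : 'rV[R]_n) (y : R) i :
  pad (row_mx x (const_mx y : 'rV_1)) i = if i == n then y else pad x i.
Proof.
case: (ltnP i (n + 1)%N) => [lt_i|].
  rewrite (padE _ (Ordinal lt_i)) mxE; case: splitP => j /= ij.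
    rewrite ij padE; case: eqP => // jn; have := ltn_ord j.
    by rewrite jn ltnn.
  by rewrite mxE ij ord1 addn0 eqxx.
move=> le_i; have lt_ni : (n < i)%N by rewrite -addn1.
rewrite gtn_eqF // /pad !insubF //=; first by rewrite ltnNge ltnW.
by rewrite ltnNge le_i.
Qed.

Section Definability.
Unset Implicit Arguments.
Context {R : realType} {D : forall n : nat, set (set 'rV[R]_n)}.
Set Implicit Arguments.
Context (D_omin : o_minimal_structure D).
Implicit Types (P Q : (nat -> R) -> Prop) (e : nat -> R).

Let D_eq n m (P : (nat -> R) -> Prop) : n = m ->
  D n [set x | P (pad x)] -> D m [set x | P (pad x)].
Proof. by move->. Qed.

Let D_ext n (A B : set 'rV[R]_n) : (forall x, A x <-> B x) -> D n A -> D n B.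
Proof.
by move=> AB; have -> : A = B by apply/seteqP; split => x /AB.
Qed.

Lemma dfn_at_ext n P Q : (forall e, P e <-> Q e) -> dfn_at D n P -> dfn_at D n
  Q.
Proof.
move=> PQ [sP DP]; split; first by move=> e e' /sP h /PQ /h /PQ.
by apply: D_ext DP => x; apply: PQ.
Qed.

Lemma dfn_ext P Q : (forall e, P e <-> Q e) -> dfn D P -> dfn D Q.
Proof. by move=> PQ [n dP]; exists n; apply: dfn_at_ext dP. Qed.

Lemma dfn_atS n P : dfn_at D n P -> dfn_at D n.+1 P.
Proof.
case=> sP DP; split.
  by move=> e e' ee'; apply: sP => i lt_in; apply: ee'; rewrite ltnW.
apply: (D_eq (addn1 n)).
apply: D_ext (om_cylr D_omin DP) => x /=.
by split; apply: sP => i /(pad_lsubmx x) ->.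
Qed.

Lemma dfn_at_le n m P : (n <= m)%N -> dfn_at D n P -> dfn_at D m P.
Proof.
move=> /subnKC <-; elim: (m - n)%N => [|k IH] dP; first by rewrite addn0.
by rewrite addnS; apply: dfn_atS; apply: IH.
Qed.

Lemma dfn_at_shift n m P : dfn_at D n P ->
  dfn_at D (m + n)%N (fun e => P (fun i => e (m + i)%N)).
Proof.
elim: m => [|m IH] dP; first by apply: dP.
have [sP DP] := IH dP; split.
  move=> e e' ee'; case: dP => + _; apply => i lt_in; apply: ee'.
  by rewrite ltn_add2l.
apply: D_ext (om_cyll D_omin DP) => x /=.
rewrite /= ; case: dP => sP' _.
by split; apply: sP' => i lt_in; rewrite pad_rsubmx ?ltn_add2l.
Qed.

Lemma dfn_not P : dfn D P -> dfn D (fun e => ~ P e).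
Proof.
move=> [n [sP DP]]; exists n; split; last exact: om_setC.
by move=> e e' ee' nP P'; apply: nP; apply: sP P' => i /ee'.
Qed.

Lemma dfn_or P Q : dfn D P -> dfn D Q -> dfn D (fun e => P e \/ Q e).
Proof.
move=> [n dP] [m dQ]; exists (maxn n m).
have [sP DP] := dfn_at_le (leq_maxl n m) dP.
have [sQ DQ] := dfn_at_le (leq_maxr n m) dQ.
split; last exact: om_setU.
by move=> e e' ee' [/(sP _ _ ee')|/(sQ _ _ ee')]; [left|right].
Qed.

Lemma dfn_and P Q : dfn D P -> dfn D Q -> dfn D (fun e => P e /\ Q e).
Proof.
move=> dP dQ; apply: (dfn_ext (P := fun e => ~ (~ P e \/ ~ Q e))).
  by move=> e; rewrite not_orP !notE.
by apply: dfn_not; apply: dfn_or; apply: dfn_not.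
Qed.

Lemma dfn_imp P Q : dfn D P -> dfn D Q -> dfn D (fun e => P e -> Q e).
Proof.
move=> dP dQ; apply: (dfn_ext (P := fun e => ~ P e \/ Q e)).
  by move=> e; rewrite -implyE.
by apply: dfn_or => //; apply: dfn_not.
Qed.

Lemma dfn_true : dfn D (fun=> True).
Proof.
exists 0%N; split => //.
by apply: D_ext (om_setC D_omin (om_set0 D_omin 0)) => x; split => // _ [].
Qed.

Lemma dfn_eq_var i j : dfn D (fun e => e i = e j).
Proof.
exists (maxn i j).+1; split.
  by move=> e e' ee'; rewrite !ee' // ltnS ?leq_maxl ?leq_maxr.
have li : (i < (maxn i j).+1)%N by rewrite ltnS leq_maxl.
have lj : (j < (maxn i j).+1)%N by rewrite ltnS leq_maxr.
apply: D_ext (om_diag D_omin (Ordinal li) (Ordinal lj)) => x /=.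
by rewrite -!padE.
Qed.

Lemma dfn_at_ex_last n P : dfn_at D n.+1 P ->
  dfn_at D n (fun e => exists y, P (fun i => if i == n then y else e i)).
Proof.
move=> [sP DP]; split.
  move=> e e' ee' [y Py]; exists y; apply: sP Py => i.
  by rewrite ltnS leq_eqVlt; case: eqP => //= _ /ee'.
have := om_proj D_omin (D_eq (esym (addn1 n)) DP).
apply: D_ext => x /=; split.
  case=> z Pz <-; exists (pad z n); apply: sP Pz => i.
  rewrite ltnS leq_eqVlt; case: eqP => [->//|_ /= lt_in].
  by rewrite pad_lsubmx.
case=> y Py; exists (row_mx x (const_mx y)); last by rewrite row_mxKl.
by apply: sP Py => i _; rewrite pad_row_mx.
Qed.

Lemma dfn_forall_ord (m : nat) (P : nat -> (nat -> R) -> Prop) :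
  (forall i, dfn D (P i)) -> dfn D (fun e => forall i, (i < m)%N -> P i e).
Proof.
move=> dP; elim: m => [|m IH]; first by apply: dfn_ext dfn_true => e; split.
apply: dfn_ext (dfn_and IH (dP m)) => e; split.
  by move=> [h Pm] i; rewrite ltnS leq_eqVlt => /orP[/eqP->|/h].
by move=> h; split => [i lt_im|]; apply: h; rewrite // ltnW.
Qed.

Lemma dfn_at_ex_tuple n m P : dfn_at D (n + m)%N P ->
  dfn_at D n (fun e => exists y : nat -> R,
    P (fun i => if (i < n)%N then e i else y (i - n)%N)).
Proof.
elim: m P => [|m IH] P dP.
  rewrite addn0 in dP; case: dP => sP DP; split.
    move=> e e' ee' [y Py]; exists y; apply: sP Py => i lt_in.
    by rewrite lt_in ee'.
  apply: D_ext DP => x; split.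
    by move=> Px; exists (fun=> 0); apply: sP Px => i ->.
  by move=> [y]; apply: sP => i ->.
rewrite addnS in dP; have := IH _ (dfn_at_ex_last dP); apply: dfn_at_ext => e.
case: dP => sP _; split.
  move=> [y [z Pz]]; exists (fun i => if i == m then z else y i).
  apply: sP Pz => i _; case: eqP => [->|ne].
    by rewrite ltnNge leq_addr /= addKn eqxx.
  case: ltnP => // le_ni; case: eqP => // eq_m; case: ne.
  by rewrite -eq_m subnKC.
move=> [y Py]; exists y, (y m); apply: sP Py => i _.
case: eqP => [->|//]; by rewrite ltnNge leq_addr /= addKn.
Qed.

(** The axioms contain no substitution of variables. [P] is read on a fresh block starting at [n],
    beyond all [s i]; equations identify entry [n + i] with entry [s i], and the block is quantified
    away. *)
Lemma dfn_reindex (s : nat -> nat) P : dfn D P ->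
  dfn D (fun e => P (fun i => e (s i))).
Proof.
move=> [m dP].
pose n := (\max_(i < m) s i).+1.
have ltn (i : nat) : (i < m)%N -> (s i < n)%N.
  by move=> im; rewrite ltnS; exact: (leq_bigmax (F :=
    fun i : 'I_m => s i) (Ordinal im)).
have h1 := dfn_at_shift n dP.
have [k h2] : dfn D (fun e => P (fun i => e (n + i)%N) /\
    forall i, (i < m)%N -> e (n + i)%N = e (s i)).
  apply: dfn_and; first by exists (n + m)%N.
  by apply: dfn_forall_ord => i; exact: dfn_eq_var.
have /(dfn_at_le (leq_addl n _)) h3 := h2.
apply: (dfn_ext _ (ex_intro _ n (dfn_at_ex_tuple h3))) => e; case: dP => sP _;
  split.
  move=> [y [Py yE]]; apply: sP Py => i im; rewrite yE //.
  by rewrite ltn.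
move=> Pe; exists (fun i => e (s i)); split.
  by apply: sP Pe => i im; rewrite ltnNge leq_addr /= addKn.
by move=> i im; rewrite ltn // ltnNge leq_addr /= addKn.
Qed.

Lemma dfn_ex (Q : R -> (nat -> R) -> Prop) :
  dfn D (fun e => Q (e 0%N) (fun i => e i.+1)) -> dfn D (fun e =>
    exists y, Q y e).
Proof.
move=> [n dQ].
(* The bound variable has index 0, whereas projections remove the last coordinate: this renaming
   moves it to position [n]. *)
pose s i := if i is j.+1 then j else n.
have [k dk] := dfn_reindex s (ex_intro _ n dQ).
have dtup : dfn D _ := ex_intro _ n (dfn_at_ex_tuple (dfn_at_le (leq_addl n k)
  dk)).
case: dQ => sQ _.
have sQ' y e e' : (forall i, (i < n)%N -> e i = e' i) -> Q y e -> Q y e'.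
  move=> ee'.
  apply: (sQ (fun i => if i is j.+1 then e j else y)
             (fun i => if i is j.+1 then e' j else y)) => -[|i] //= lt_in.
  by rewrite ee' // ltnW.
apply: dfn_ext dtup => e; split.
  move=> [y]; rewrite ltnn subnn => Qy; exists (y 0%N).
  by apply: sQ' Qy => i ->.
move=> [y Qy]; exists (fun=> y); rewrite ltnn.
by apply: sQ' Qy => i ->.
Qed.

Lemma dfn_all (Q : R -> (nat -> R) -> Prop) :
  dfn D (fun e => Q (e 0%N) (fun i => e i.+1)) ->
  dfn D (fun e => forall y, Q y e).
Proof.
move=> dQ; apply: (dfn_ext (P := fun e => ~ exists y, ~ Q y e)).
  by move=> e; rewrite -forallNP; split=> h y;
    [apply: contrapT|move=> /(_ (h y))].
by apply/dfn_not/(dfn_ex (Q := fun y e => ~ Q y e))/dfn_not.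
Qed.

Lemma dfn_D n (A : set 'rV[R]_n) (s : 'I_n -> nat) : D n A ->
  dfn D (fun e => A (\row_i e (s i))).
Proof.
move=> DA.
have : dfn D (fun e => A (\row_i e i)).
  exists n; split.
    move=> e e' ee'; congr A; apply/rowP => i; rewrite !mxE ee' //.
  by apply: D_ext DA => x /=; rewrite (_ : \row_i _ = x) //; apply/rowP => i;
    rewrite mxE padE.
move=> /(dfn_reindex (fun i => if insub i is Some j then s j else 0%N)).
apply: dfn_ext => e; suff -> : \row_i e (if insub (val i) is Some j then s j
  else 0%N) = \row_i e (s i) by [].
by apply/rowP => i; rewrite !mxE valK.
Qed.

(** Substitution of a term for a variable, by means of an existential quantifier. Composition of
    definable functions and comparison of terms reduce to it. *)
Lemma dfn_term (t : (nat -> R) -> R) (Q : R -> (nat -> R) -> Prop) :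
  dterm D t -> dfn D (fun e => Q (e 0%N) (fun i => e i.+1)) ->
  dfn D (fun e => Q (t e) e).
Proof.
move=> dt dQ; apply: (dfn_ext (P := fun e => exists y, y = t e /\ Q y e)).
  by move=> e; split=> [[y [->]]|] //; exists (t e).
apply: (dfn_ex (Q := fun y e => y = t e /\ Q y e)); exact: dfn_and.
Qed.

Lemma dterm_shift t : dterm D t -> dterm D (fun e => t (fun i => e i.+1)).
Proof. by move=> /(dfn_reindex (fun i => if i is j.+1 then j.+2 else 0%N)). Qed.

Lemma dterm_var i : dterm D (fun e => e i).
Proof. exact: dfn_eq_var. Qed.

Lemma dterm_app f t : definable1 D f -> dterm D t -> dterm D (fun e => f (t e)).
Proof.
move=> df dt.
apply: (dfn_term (t := fun e => t (fun i => e i.+1)) (Q :=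
  fun y e => e 0%N = f y)).
  exact: dterm_shift.
by apply: dfn_reindex (fun i => if i is 0 then 1%N else 0%N) _ df.
Qed.

Lemma dterm_app2 f t u : definable2 D f -> dterm D t -> dterm D u ->
  dterm D (fun e => f (t e) (u e)).
Proof.
move=> df dt du.
apply: (dfn_term (t := fun e => t (fun i => e i.+1))
  (Q := fun y e => e 0%N = f y (u (fun i => e i.+1)))).
  exact: dterm_shift.
apply: (dfn_term (t := fun e => u (fun i => e i.+2))
  (Q := fun y e => e 1%N = f (e 0%N) y)).
  exact: dterm_shift (dterm_shift du).
by apply: dfn_reindex (fun i => nth 0%N [:: 2; 1; 0] i)%N _ df.
Qed.

Lemma dfn_lt_var i j : dfn D (fun e => e i < e j).
Proof.
have := dfn_D (fun k : 'I_2 => if k == 0 then i else j) (om_lt D_omin).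
by apply: dfn_ext => e /=; rewrite !mxE.
Qed.

Lemma dfn_lt t u : dterm D t -> dterm D u -> dfn D (fun e => t e < u e).
Proof.
move=> dt du; apply: (dfn_term (Q := fun y e => y < u e) dt).
apply: (dfn_term (Q := fun y e => e 0%N < y)  (dterm_shift du)).
exact: dfn_lt_var.
Qed.

Lemma dfn_eq t u : dterm D t -> dterm D u -> dfn D (fun e => t e = u e).
Proof. by move=> dt du; apply: (dfn_term (Q := fun y e => y = u e) dt). Qed.

Lemma dfn_le t u : dterm D t -> dterm D u -> dfn D (fun e => t e <= u e).
Proof.
move=> dt du; apply: dfn_ext (dfn_not (dfn_lt du dt)) => e.
by rewrite leNgt; split=> /negP.
Qed.

Lemma definable2_add : definable2 D +%R.
Proof.
have := dfn_D (fun k : 'I_3 => nth 0%N [:: 1; 2; 0] k)%N (om_add D_omin).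
by apply: dfn_ext => e /=; rewrite !mxE.
Qed.

Lemma definable2_mul : definable2 D *%R.
Proof.
have := dfn_D (fun k : 'I_3 => nth 0%N [:: 1; 2; 0] k)%N (om_mul D_omin).
by apply: dfn_ext => e /=; rewrite !mxE.
Qed.

(** Real parameters are allowed: a singleton is an interval, hence definable by the converse
    direction of [om_line]. *)
Lemma dterm_cst c : dterm D (fun=> c).
Proof.
have dc : D 1%N [set x : 'rV[R]_1 | x 0 0 = c].
  apply/(om_line D_omin); exists [:: `[c, c]%R]; apply/seteqP; split=> x /=.
    by move=> <-; exists `[x 0 0, x 0 0]; rewrite ?mem_head // in_itv /= lexx.
  by move=> [i]; rewrite inE => /eqP ->; rewrite in_itv /= => /le_anti.
have := dfn_D (fun=> 0%N) dc.
by apply: dfn_ext => e /=; rewrite !mxE.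
Qed.

Lemma dterm_add t u : dterm D t -> dterm D u -> dterm D (fun e => t e + u e).
Proof. exact: dterm_app2 definable2_add. Qed.

Lemma dterm_mul t u : dterm D t -> dterm D u -> dterm D (fun e => t e * u e).
Proof. exact: dterm_app2 definable2_mul. Qed.

Lemma dterm_opp t : dterm D t -> dterm D (fun e => - t e).
Proof.
move=> dt; have := dterm_mul (dterm_cst (- 1)) dt.
by apply: dfn_ext => e; rewrite mulN1r.
Qed.

Lemma definable1_inv : definable1 D GRing.inv.
Proof.
apply: (dfn_ext (P := fun e => e 0%N * e 1%N = 1 \/ (e 1%N = 0 /\ e 0%N = 0))).
  move=> e; split.
    case=> [h|[-> ->]]; last by rewrite invr0.
    have e0 : e 1%N != 0 by apply: contra_eq_neq h => ->;
      rewrite mulr0 eq_sym oner_eq0.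
    by apply: (mulIf e0); rewrite h mulVf.
  move=> ->; have [->|e0] := eqVneq (e 1%N) 0; first by right; rewrite invr0.
  by left; rewrite mulVf.
apply: dfn_or.
  by apply: dfn_eq (dterm_mul (dterm_var 0) (dterm_var 1)) (dterm_cst 1).
by apply: dfn_and; apply: dfn_eq (dterm_var _) (dterm_cst 0).
Qed.

Lemma dterm_inv t : dterm D t -> dterm D (fun e => (t e)^-1).
Proof. exact: dterm_app definable1_inv. Qed.

Lemma dterm_norm t : dterm D t -> dterm D (fun e => `|t e|).
Proof.
apply: dterm_app; apply: (dfn_ext (P := fun e =>
  (0 <= e 1%N /\ e 0%N = e 1%N) \/ (e 1%N <= 0 /\ e 0%N = - e 1%N))).
  move=> e; split; first by case=> -[h ->]; [rewrite ger0_norm|rewrite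
    ler0_norm].
  move=> ->; have [h|h] := leP 0 (e 1%N); first by left; rewrite ger0_norm.
  by right; rewrite ltW // ltr0_norm.
have v := dterm_var; have c := dterm_cst 0.
apply: dfn_or; apply: dfn_and; [exact: dfn_le|exact: dfn_eq|exact: dfn_le|].
by apply: dfn_eq => //; exact: dterm_opp.
Qed.

(** Variables from index [n] on do not affect the truth of [P]; projecting them away restores the
    exact arity. *)
Lemma dfn_supported n P : supported n P -> dfn D P -> D n [set x | P (pad x)].
Proof.
move=> sP [m dP]; have [_] := dfn_at_ex_tuple (dfn_at_le (leq_addl n m) dP).
apply: D_ext => x /=; split=> [[y]|Px]; last exists (fun=> 0).
  by apply: sP => i ->.
by apply: sP Px => i ->.
Qed.

Lemma dset_itv (A : set R) : dset D A -> exists s : seq (interval R),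
  A = [set x | exists2 i : interval R, i \in s & x \in i].
Proof.
move=> dA; have {}dA : D 1%N [set x : 'rV[R]_1 | A (pad x 0)].
  by apply: dfn_supported dA => e e' ee'; rewrite ee'.
have D1 : D 1%N [set x : 'rV[R]_1 | A (x 0 0)].
  by apply: D_ext dA => x /=; rewrite (padE x 0).
have [s sE] := (om_line D_omin _).1 D1; exists s; apply/seteqP.
have E x : A x = [set y : 'rV_1 | A (y 0 0)] (const_mx x) by rewrite /= mxE.
by split=> x; rewrite E sE /= mxE.
Qed.

(** A filter that places its variable on one side of each real number decides each endpoint
    condition, hence each interval and each finite union of intervals. It is used at infinity and at
    0 from the right. *)
Lemma dset_filter (F : set_system R) (FF : ProperFilter F) :
  (forall x, (\forall t \near F, t < x) \/ (\forall t \near F, x < t)) ->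
  forall A : set R, dset D A -> (\forall t \near F, A t) \/ (\forall t \near F,
    ~ A t).
Proof.
move=> Flt A /dset_itv[s ->]; elim: s => [|[l u] s IH].
  by right; near=> t; case.
have dl : (\forall t \near F, (l <= BLeft t)%O) \/
          (\forall t \near F, ~~ (l <= BLeft t)%O).
  case: l => [b x|[]]; last 2 first.
  - by left; near=> t.
  - by right; near=> t.
  case: (Flt x) => h; [right|left]; apply: filterS h => t lt_t; case: b;
    by rewrite bnd_simp -?ltNge -?leNgt ?ltW.
have du : (\forall t \near F, (BRight t <= u)%O) \/
          (\forall t \near F, ~~ (BRight t <= u)%O).
  case: u => [b x|[]]; last 2 first.
  - by right; near=> t.
  - by left; near=> t.
  case: (Flt x) => h; [left|right]; apply: filterS h => t lt_t; case: b;
    by rewrite bnd_simp -?ltNge -?leNgt ?ltW.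
have di : (\forall t \near F, t \in Interval l u) \/
          (\forall t \near F, t \notin Interval l u).
  case: dl => hl; last by right; apply: filterS hl => t;
    rewrite itv_boundlr => /negbTE ->.
  case: du => hu; last by right; apply: filterS hu => t;
    rewrite itv_boundlr andbC => /negbTE ->.
  by left; apply: filterS2 hl hu => t tl tu; rewrite itv_boundlr tl tu.
case: di => hi.
  by left; apply: filterS hi => t ti /=; exists (Interval l u);
    rewrite ?mem_head.
case: IH => hs; [left|right].
  by apply: filterS hs => t [i si ti]; exists i => //; rewrite inE si orbT.
apply: filterS2 hi hs => t /negP ti ns [j]; rewrite inE => /predU1P[->//|js tj].
by apply: ns; exists j.
Unshelve. all: by end_near.
Qed.

Lemma dset_pinfty (A : set R) : dset D A ->
  (\forall t \near +oo, A t) \/ (\forall t \near +oo, ~ A t).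
Proof.
apply: dset_filter => x; right; exact: nbhs_pinfty_gt (num_real x).
Qed.

Lemma right_of_0P (P : R -> Prop) : right_of_0 P <-> \forall h \near 0^'+, P h.
Proof.
split=> [[d [d0 dP]]|].
  near=> h; apply: dP; near: h; first exact: nbhs_right_gt.
  exact: nbhs_right_lt.
move=> /nbhs_ballP[d /= d0 dP]; exists d; split=> // h h0 hd; apply: dP => //=.
by rewrite /ball /= sub0r normrN gtr0_norm.
Unshelve. all: by end_near.
Qed.

Lemma dset_right_of_0 (A : set R) : dset D A ->
  right_of_0 A \/ right_of_0 (fun h => ~ A h).
Proof.
rewrite !right_of_0P; apply: dset_filter => x; have [x0|x0] := leP x 0.
  by right; near=> h; apply: le_lt_trans x0 _; near: h; exact: nbhs_right_gt.
by left; exact: nbhs_right_lt.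
Unshelve. all: by end_near.
Qed.

(** Of finitely many intervals, either one has two distinct points or each has at most one point. *)
Lemma dset_large (A : set R) : dset D A ->
  countable A \/ exists u v, u < v /\ (forall t, u < t -> t < v -> A t).
Proof.
move=> /dset_itv[s ->].
have [/hasP[i si /asboolP[u [v [uv ui vi]]]]|/hasPn ns] :=
  boolP (has (fun i : interval R => `[< exists u v, [/\ u < v,
    u \in i & v \in i] >]) s).
  right; exists u, v; split=> // t ut tv; exists i => //.
  by apply: (@interval_is_interval _ i u v) => //; rewrite (ltW ut) (ltW tv).
left.
have -> : [set x | exists2 i : interval R, i \in s & x \in i] =
   \bigcup_(i in [set i | i \in s]) [set` i].
  by apply/seteqP; split => x /= [i]; exists i.
apply: bigcup_countable => [|i si]; first exact/finite_set_countable/finite_seq.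
have [->|/set0P[x xi]] := eqVneq [set` i] set0; first exact: countable0.
apply: sub_countable (countable1 x); apply: subset_card_le => y yi /=.
apply: contrapT => /eqP; rewrite neq_lt => xy.
have /asboolPn[] := ns i si; case/orP: xy => h.
  by exists y, x.
by exists x, y.
Qed.

(** If no [A i] contained an interval beyond [a], all would be countable there, and so would []a, a
    + 1[], against its Lebesgue measure. Irregularity is thus split into countably many cases
    indexed by rationals, one of which must hold on an interval. *)
Lemma dset_cover (I : countType) (A : I -> set R) a : (forall i,
  dset D (A i)) ->
  (forall t, a < t -> exists i, A i t) ->
  exists i u v, [/\ a < u, u < v & forall t, u < t -> t < v -> A i t].
Proof.
move=> dA cA; apply: contrapT => nA.
pose B i := A i `&` [set t | a < t].
have cB i : countable (B i).
  have dB : dset D (B i) := dfn_and (dA i) (dfn_lt (dterm_cst a) (dterm_var 0)).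
  case: (dset_large dB) => // -[u [v [uv BE]]]; case: nA.
  exists i, ((u + v) / 2), v; have lu := midf_lt uv; split; [|by case: lu|].
    by case: (BE ((u + v) / 2)) => //; case: lu.
  by move=> t ut tv; case: (BE t) => //; apply: lt_trans ut; case: lu.
have cU : countable `]a, (a + 1)[%classic.
  apply: sub_countable (bigcup_countable (countableP [set: I]) (fun i _ =>
    cB i)).
  apply: subset_card_le => t /=; rewrite in_itv /= => /andP[ta _].
  by have [i Ai] := cA t ta; exists i.
have := countable_lebesgue_measure0 cU.
rewrite lebesgue_measure_itv /= lte_fin ltrDl ltr01 -EFinB addrAC subrr add0r.
by move=> /eqP; rewrite eqe oner_eq0.
Qed.

End Definability.

(** * Continuity and derivability of definable functions near infinity *)

(** Reads definability off the syntax of a formula. Compound predicates must first be unfolded to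
    quantifiers over real numbers. *)
Ltac definability :=
  cbv beta;
  lazymatch goal with
  | |- dset _ _ => unfold dset; definability
  | |- definable1 _ _ => unfold definable1; definability
  | |- dfn _ (fun=> True) => apply dfn_true; assumption
  | |- dfn _ (fun e => _ /\ _) => apply dfn_and;
    [assumption|definability|definability]
  | |- dfn _ (fun e => _ \/ _) => apply dfn_or;
    [assumption|definability|definability]
  | |- dfn _ (fun e => ~ _) => apply dfn_not; [assumption|definability]
  | |- dfn _ (fun e => exists y : _, @?Q e y) =>
      apply (dfn_ex ltac:(eassumption) (Q := fun y e => Q e y)); definability
  | |- dfn _ (fun e => forall y : Real.sort _, @?Q e y) =>
      apply (dfn_all ltac:(eassumption) (Q := fun y e => Q e y)); definability
  | |- dfn _ (fun e => @?P e -> @?Q e) =>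
      apply (dfn_imp ltac:(eassumption) (P := P) (Q := Q)); definability
  | |- dfn _ (fun e => is_true (@?t e < @?u e)) =>
      apply (dfn_lt ltac:(eassumption) (t := t) (u := u)); definability
  | |- dfn _ (fun e => is_true (@?t e <= @?u e)) =>
      apply (dfn_le ltac:(eassumption) (t := t) (u := u)); definability
  | |- dfn _ (fun e => @?t e = @?u e) =>
      apply (dfn_eq ltac:(eassumption) (t := t) (u := u)); definability
  | |- dterm _ (fun=> ?c) => apply dterm_cst; assumption
  | |- dterm _ (fun e => e ?i) => apply dterm_var; assumption
  | |- dterm _ (fun e => @?t e + @?u e) =>
      apply (dterm_add ltac:(eassumption) (t := t) (u := u)); definability
  | |- dterm _ (fun e => @?t e * @?u e) =>
      apply (dterm_mul ltac:(eassumption) (t := t) (u := u)); definability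
  | |- dterm _ (fun e => - (@?t e)) =>
      apply (dterm_opp ltac:(eassumption) (t := t)); definability
  | |- dterm _ (fun e => (@?t e)^-1) =>
      apply (dterm_inv ltac:(eassumption) (t := t)); definability
  | |- dterm _ (fun e => `|@?t e|) =>
      apply (dterm_norm ltac:(eassumption) (t := t)); definability
  | H : definable1 _ ?f |- dterm _ (fun e => ?f (@?t e)) =>
      apply (dterm_app ltac:(eassumption) H (t := t)); definability
  | |- _ => idtac
  end.

(** * Monotonicity from a one-sided local condition *)

Section MonotoneRightward.
Context {R : realType}.

(** This condition and the next are written with quantifiers over reals, not as limits, so that
    [definability] applies to them. *)
Definition cont_at (f : R -> R) (t : R) := forall eps : R, 0 < eps ->
  exists d : R, 0 < d /\ forall y : R, `|y - t| < d -> `|f y - f t| < eps.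

Definition deriv_at (f : R -> R) (t l : R) := forall eps : R, 0 < eps ->
  exists d : R, 0 < d /\ forall h : R, ~ h = 0 -> `|h| < d ->
    `|f (h + t) - f t - l * h| <= eps * `|h|.

Lemma near_pinftyP (P : R -> Prop) :
  (\forall t \near +oo, P t) <-> exists a, forall t, a < t -> P t.
Proof.
split=> [[a [_ aP]]|[a aP]]; first by exists a.
by exists a; split => //; exact: num_real.
Qed.

Lemma right_of_0_and (P Q : R -> Prop) : right_of_0 P -> right_of_0 Q ->
  right_of_0 (fun h => P h /\ Q h).
Proof. by rewrite !right_of_0P => hP hQ; apply: filterS2 hP hQ. Qed.

Lemma right_of_0_ex (P : R -> Prop) : right_of_0 P -> exists h, 0 < h /\ P h.
Proof.
move=> [d [d0 dP]]; exists (d / 2); split; first lra.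
by apply: dP; lra.
Qed.

Lemma right_of_0S (P Q : R -> Prop) : (forall h, 0 < h -> P h -> Q h) ->
  right_of_0 P -> right_of_0 Q.
Proof.
by move=> PQ [d [d0 dP]]; exists d; split=> // h h0 hd; apply: PQ => //;
  apply: dP.
Qed.

(** Real induction: let [c] be the supremum of the [s] such that [g x <= g r] for all [r] in
    [[x, s]]. Continuity gives [g x <= g c], and the condition to the right of [c] leads beyond [c]
    unless [c = y]. *)
Lemma rightward_nondecreasing (g : R -> R) (u v : R) :
  (forall t, u < t -> t < v -> cont_at g t) ->
  (forall t, u < t -> t < v -> right_of_0 (fun h => g t <= g (t + h))) ->
  forall x y, u < x -> x <= y -> y < v -> g x <= g y.
Proof.
move=> gc gr x y ux xy yv.
pose S := [set s | x <= s <= y /\ forall r, x <= r -> r <= s -> g x <= g r].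
have Sx : S x by split=> [|r xr rx]; rewrite ?lexx //;
  have -> : r = x by apply/le_anti; rewrite rx xr.
have ubS : ubound S y by move=> s [] /andP[].
have hS : has_sup S by split; [exists x|exists y].
pose c := sup S.
have xc : x <= c by apply: ub_le_sup Sx; exists y.
have cy : c <= y by apply: ge_sup => //; exists x.
have below r : x <= r -> r < c -> g x <= g r.
  move=> xr rc; have [s [_ Ss] /ltW rs] := sup_adherent (eps :=
    c - r) ltac:(by rewrite subr_gt0) hS.
  by apply: Ss => //; move: rs; rewrite -/c opprB addrC subrK.
have gxc : g x <= g c.
  rewrite leNgt; apply/negP => gcx.
  have [e|ne] := eqVneq x c; first by rewrite -e ltxx in gcx.
  have xc' : x < c by rewrite lt_neqAle ne.
  have [d [d0 dP]] := gc c ltac:(lra) ltac:(lra) (g x - g c) ltac:(lra).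
  pose r := Num.max x (c - d / 2).
  have xr : x <= r by rewrite le_max lexx.
  have rc : r < c by rewrite gt_max xc' /=; lra.
  have dr : c - d / 2 <= r by rewrite le_max lexx orbT.
  have gr' := below r xr rc; have : `|r - c| < d by rewrite ltr_norml; lra.
  by move=> /dP; rewrite ltr_norml; lra.
have [<-//|ne] := eqVneq c y; have cy' : c < y by rewrite lt_neqAle ne.
have [d [d0 dP]] := gr c ltac:(lra) ltac:(lra).
pose s := Num.min y (c + d / 2).
have cs : c < s by rewrite lt_min cy' /=; lra.
have sd : s <= c + d / 2 by rewrite ge_min lexx orbT.
have Ss : S s.
  split; first by rewrite ge_min lexx /= andbT; lra.
  move=> r xr rs; have [rc|cr] := ltP r c; first exact: below.
  have [->//|nrc] := eqVneq r c.
  have cr' : c < r by rewrite lt_neqAle eq_sym nrc.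
  have := dP (r - c) ltac:(lra) ltac:(lra); rewrite addrC subrK; lra.
have : s <= c by apply: ub_le_sup Ss; exists y.
lra.
Qed.

End MonotoneRightward.

Section Differentiability.
Unset Implicit Arguments.
Context {R : realType} {D : forall n : nat, set (set 'rV[R]_n)}.
Set Implicit Arguments.
Context (D_omin : o_minimal_structure D).
Implicit Types f g : R -> R.

Lemma dset_cont_at f : definable1 D f -> dset D (cont_at f).
Proof. by move=> df; rewrite /cont_at; definability. Qed.

Lemma dfn_deriv_at f : definable1 D f ->
  dfn D (fun e => deriv_at f (e 1%N) (e 0%N)).
Proof. by move=> df; rewrite /deriv_at; definability. Qed.

Lemma rat_between (x y : R) : x < y -> exists q : rat, x < ratr q /\ ratr q < y.
Proof. by move=> /rat_in_itvoo[q]; rewrite in_itv /= => /andP[]; exists q. Qed.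

(** At a discontinuity some rational separates [f t] from all nearby values on one side. If all
    large points were discontinuities, one rational and one side would serve on a whole interval,
    and three suitable points there would lie pairwise on opposite sides of that rational. *)
Lemma definable_eventually_cont f : definable1 D f ->
  \forall t \near +oo, cont_at f t.
Proof.
move=> df; have [//|/near_pinftyP[a na]] := dset_pinfty D_omin (dset_cont_at
  df).
pose A (i : bool * rat) t := right_of_0 (fun h =>
  (f t - ratr i.2) * (f (t + (-1) ^+ i.1 * h) - ratr i.2) < 0).
have dA i : dset D (A i) by rewrite /A /right_of_0; definability.
have cA t : a < t -> exists i, A i t.
  move=> /na nc; apply: contrapT => nA; apply: nc => eps eps0.
  have near_f (b : bool) : right_of_0 (fun h =>
    `|f (t + (-1) ^+ b * h) - f t| < eps).
    have d1 : dset D (fun h => `|f (t + (-1) ^+ b * h) - f t| < eps) by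
      definability.
    have d2 : dset D (fun h => f (t + (-1) ^+ b * h) < f t) by definability.
    have [//|nf] := dset_right_of_0 D_omin d1.
    have [lo|up] := dset_right_of_0 D_omin d2.
      have [q [q1 q2]] := rat_between (x := f t - eps) (y := f t) ltac:(lra).
      case: nA; exists (b, q); apply: right_of_0S (right_of_0_and lo nf) =>
        h h0 /= [lth /negP].
      by rewrite -leNgt ler0_norm; [nra|lra].
    have [q [q1 q2]] := rat_between (x := f t) (y := f t + eps) ltac:(lra).
    case: nA; exists (b, q); apply: right_of_0S (right_of_0_and up nf) =>
      h h0 /= [/negP lth /negP].
    by rewrite -leNgt in lth; rewrite -leNgt ger0_norm; [nra|lra].
  have [d1 [d10 d1P]] := near_f false; have [d2 [d20 d2P]] := near_f true.
  exists (Num.min d1 d2); rewrite lt_min d10 d20; split => // y.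
  rewrite lt_min => /andP[y1 y2]; have [lt_yt|lt_ty|->] := ltgtP y t.
  - rewrite ltr0_norm in y1 y2; try lra.
    have := d2P (t - y) ltac:(lra) ltac:(lra).
    by rewrite expr1 (_ : t + _ = y) //; lra.
  - rewrite gtr0_norm in y1 y2; try lra.
    have := d1P (y - t) ltac:(lra) ltac:(lra).
    by rewrite expr0 (_ : t + _ = y) //; lra.
  - by rewrite subrr normr0.
have [[b q] [u [v [au uv Auv]]]] := dset_cover D_omin dA cA.
have [lum lmv] := midf_lt uv.
set m := (u + v) / 2 in lum lmv.
have [d [d0 dP]] := Auv m lum lmv.
pose e := Num.min d (Num.min (v - m) (m - u)) / 2.
have e0 : 0 < e by rewrite divr_gt0 // !lt_min d0; lra.
have [ed [ev eu]] : e < d /\ e < v - m /\ e < m - u.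
  have e2 : e * 2 = Num.min d (Num.min (v - m) (m - u)) by rewrite divfK.
  have : e * 2 <= d by rewrite e2 ge_min lexx.
  have : e * 2 <= v - m by rewrite e2 ge_min ge_min lexx orbT.
  have : e * 2 <= m - u by rewrite e2 ge_min ge_min lexx !orbT.
  by move=> *; split; [lra|split; lra].
have mu : u < m + (-1) ^+ b * e by case: b {Auv dP}; rewrite ?expr0 ?expr1; lra.
have mv : m + (-1) ^+ b * e < v by case: b {Auv dP mu}; rewrite ?expr0 ?expr1;
  lra.
have small : right_of_0 (fun h => h < d - e) by exists (d - e); split; [lra|].
have [h [h0 [/= Ah hlt]]] := right_of_0_ex (right_of_0_and (Auv _ mu mv) small).
have AC := dP e e0 ed; have AB := dP (e + h) ltac:(lra) ltac:(lra).
rewrite /= in Ah AC AB; rewrite (mulrDr _ e h) addrA in AB.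
set A0 := f m - _ in AC AB; set B0 := f (m + _) - _ in AC Ah.
set C0 := f _ - _ in AB Ah.
have : 0 < A0 * B0 * (A0 * C0) by rewrite nmulr_rgt0.
have A2 := sqr_ge0 A0; have : A0 ^+ 2 * (B0 * C0) <= 0 by rewrite mulr_ge0_le0
  // ltW.
by lra.
Qed.

(* A definable function fails to be derivable at [t] only if one slope is
   infinite there or a rational number separates the slopes on both sides; the
   sign [b] reduces the four cases to two. *)
Definition bad_slope f (b : bool) (o : option rat) (t : R) : Prop :=
  if o is Some q then
    right_of_0 (fun h => ratr q * h < (-1) ^+ b * (f (t + h) - f t)) /\
    right_of_0 (fun h => - ratr q * h < (-1) ^+ b * (f (t - h) - f t))
  else forall q : R, right_of_0 (fun h => q * h < (-1) ^+ b * (f (t + h) - f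
    t)).

(** The condition on right-hand slopes makes [(-1) ^+ b * f t - q * t] nondecreasing. For a finite
    [q] this contradicts the condition on left-hand slopes at the midpoint. For infinite slopes it
    would hold for every [q], in particular for one above the average slope between two points. *)
Lemma bad_slope_nowhere f b o u v : u < v ->
  (forall t, u < t -> t < v -> cont_at f t) ->
  ~ (forall t, u < t -> t < v -> bad_slope f b o t).
Proof.
move=> uv fc bad.
have mono (q : R) : (forall t, u < t -> t < v ->
    right_of_0 (fun h => q * h < (-1) ^+ b * (f (t + h) - f t))) ->
    forall x y, u < x -> x <= y -> y < v ->
    (-1) ^+ b * f x - q * x <= (-1) ^+ b * f y - q * y.
  move=> hq; apply: (@rightward_nondecreasing R (fun t =>
    (-1) ^+ b * f t - q * t)).
    move=> t ut tv eps eps0; have [d [d0 dP]] :=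
      fc t ut tv (eps / 2) ltac:(lra).
    pose k := eps / 2 / (`|q| + 1).
    have q0 := normr_ge0 q.
    have k0 : 0 < k by rewrite !divr_gt0; lra.
    exists (Num.min d k); rewrite lt_min d0 k0; split => // y.
    rewrite lt_min => /andP[/dP yd yk].
    have -> : (-1) ^+ b * f y - q * y - ((-1) ^+ b * f t - q * t) =
      (-1) ^+ b * (f y - f t) + - q * (y - t) by ring.
    apply: le_lt_trans (ler_normD _ _) _.
    rewrite !normrM normrX normrN1 expr1n mul1r normrN.
    have : k * (`|q| + 1) = eps / 2 by rewrite divfK //; lra.
    have := normr_ge0 (y - t); nra.
  by move=> t ut tv; apply: right_of_0S (hq t ut tv) => h h0; lra.
have [lum lmv] := midf_lt uv; set m := (u + v) / 2 in lum lmv.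
case: o bad => [q|] bad.
  have [_ [d [d0 dP]]] := bad m lum lmv.
  have mq := mono (ratr q) (fun t ut tv => (bad t ut tv).1).
  pose h := Num.min d (m - u) / 2.
  have h2 : h * 2 = Num.min d (m - u) by rewrite divfK.
  have h0 : 0 < h by rewrite divr_gt0 // lt_min d0; lra.
  have hd : h * 2 <= d by rewrite h2 ge_min lexx.
  have hu : h * 2 <= m - u by rewrite h2 ge_min lexx orbT.
  have := mq (m - h) m ltac:(lra) ltac:(lra) ltac:(lra).
  have := dP h h0 ltac:(lra); nra.
pose y := (m + v) / 2; have [my yv] : m < y /\ y < v by rewrite /y; lra.
pose M := ((-1) ^+ b * f y - (-1) ^+ b * f m + 1) / (y - m).
have ME : M * (y - m) = (-1) ^+ b * f y - (-1) ^+ b * f m + 1 by rewrite divfK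
  //; lra.
have := mono M (fun t ut tv => bad t ut tv M) m y lum ltac:(lra) yv; lra.
Qed.

(** If no slope is bad, the right-hand derivative is the supremum [l] of the eventual lower bounds
    of right-hand slopes, finite because infinite slopes are bad. Left-hand slopes tend to [l] as
    well: a gap would contain a rational, which is the other bad case. *)
Lemma derivable_or_bad_slope f t : definable1 D f ->
  (exists l, deriv_at f t l) \/ exists b o, bad_slope f b o t.
Proof.
move=> df; have [|nbad] := pselect (exists b o, bad_slope f b o t);
  first by right.
left.
have dec (c a q : R) : right_of_0 (fun h => q * h < c * (f (t + a * h) - f t))
  \/
    right_of_0 (fun h => ~ (q * h < c * (f (t + a * h) - f t))).
  by apply: (dset_right_of_0 D_omin); definability.
pose S := [set q | right_of_0 (fun h => q * h < f (t + h) - f t)].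
have S0 : S !=set0.
  apply: contrapT => nS; apply: nbad; exists true, None => q.
  have [h|] := dec 1 1 (- q - 1).
    case: nS; exists (- q - 1); apply: right_of_0S h => h h0; rewrite !mul1r //.
  by apply: right_of_0S => h h0 /negP; rewrite -leNgt expr1 !mul1r; lra.
have [M SM] : exists M, right_of_0 (fun h => f (t + h) - f t <= M * h).
  apply: contrapT => nM; apply: nbad; exists false, None => q.
  have [|h] := dec 1 1 q.
    by apply: right_of_0S => h h0; rewrite expr0 !mul1r.
  by case: nM; exists q; apply: right_of_0S h => h h0 /negP;
    rewrite -leNgt !mul1r.
have hS : has_sup S.
  split=> //; exists M => q Sq; have [h [h0 [h1 h2]]] :=
    right_of_0_ex (right_of_0_and Sq SM).
  by rewrite -(ler_pM2r h0) ltW // (lt_le_trans h1).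
pose l := sup S; exists l => eps eps0.
have lower q : q < l -> right_of_0 (fun h => q * h < f (t + h) - f t).
  move=> ql; have [s Ss qs] := sup_adherent (eps :=
    l - q) ltac:(by rewrite subr_gt0) hS.
  apply: right_of_0S Ss => h h0; apply: lt_trans; rewrite ltr_pM2r //.
  by move: qs; rewrite -/l opprB addrC subrK.
have upper q : l < q -> right_of_0 (fun h => f (t + h) - f t <= q * h).
  move=> lq; have [h|] := dec 1 1 q.
    suff : q <= l by rewrite leNgt lq.
    apply: ub_le_sup; first by case: hS.
    by apply: right_of_0S h => h h0; rewrite !mul1r.
  by apply: right_of_0S => h h0 /negP; rewrite -leNgt !mul1r.
have lowerL q : q < l -> right_of_0 (fun h => f (t - h) - f t <= - q * h).
  move=> ql; have [p [qp pl]] := rat_between ql.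
  have [h|] := dec 1 (- 1) (- q).
    case: nbad; exists false, (Some p); split.
      by apply: right_of_0S (lower _ pl) => k k0; rewrite expr0 !mul1r.
    apply: right_of_0S h => k k0; rewrite expr0 !mul1r mulN1r.
    have := mulr_gt0 k0 (_ : 0 < ratr p - q); rewrite subr_gt0 => /(_ qp).
    by lra.
  by apply: right_of_0S => h h0 /negP; rewrite -leNgt !mul1r mulN1r.
have upperL q : l < q -> right_of_0 (fun h => - q * h <= f (t - h) - f t).
  move=> lq; have [p [lp pq]] := rat_between lq.
  (* [upper] gives a weak inequality only; applied at [r < p], it becomes strict at [p]. *)
  have [r [lr rp]] := rat_between lp.
  have [h|] := dec (- 1) (- 1) q.
    case: nbad; exists true, (Some (- p)); split.
      apply: right_of_0S (upper _ lr) => k k0; rewrite expr1 rmorphN /=.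
      have := mulr_gt0 k0 (_ : 0 < ratr p - ratr r);
        rewrite subr_gt0 => /(_ rp).
      by lra.
    apply: right_of_0S h => k k0; rewrite expr1 rmorphN /= !mulN1r.
    have := mulr_gt0 k0 (_ : 0 < q - ratr p); rewrite subr_gt0 => /(_ pq).
    by lra.
  by apply: right_of_0S => h h0 /negP; rewrite -leNgt !mulN1r; lra.
have [d [d0 dP]] := right_of_0_and
  (right_of_0_and (lower (l - eps) ltac:(lra)) (upper (l + eps) ltac:(lra)))
  (right_of_0_and (lowerL (l - eps) ltac:(lra)) (upperL (l + eps) ltac:(lra))).
exists d; split=> // h /eqP; rewrite neq_lt => /orP[] h0 hd.
  rewrite ltr0_norm // in hd *; have [_] := dP (- h) ltac:(lra) hd.
  rewrite opprK (addrC h) ler_norml; lra.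
rewrite gtr0_norm // in hd *; have [+ _] := dP h h0 hd.
rewrite (addrC h) ler_norml; lra.
Qed.

Lemma definable_eventually_deriv f : definable1 D f ->
  \forall t \near +oo, exists l, deriv_at f t l.
Proof.
move=> df.
have dA : dset D (fun t => exists l : R, deriv_at f t l).
  by rewrite /deriv_at; definability.
have [//|/near_pinftyP[a na]] := dset_pinfty D_omin dA.
have /near_pinftyP[a' ca] := definable_eventually_cont df.
have dW (i : bool * option rat) : dset D (bad_slope f i.1 i.2).
  by case: i => b [q|]; rewrite /bad_slope /right_of_0 /=; definability.
have cA t : Num.max a a' < t -> exists i : bool * option rat,
  bad_slope f i.1 i.2 t.
  rewrite gt_max => /andP[/na nd _].
  by case: (derivable_or_bad_slope t df) => [/nd|[b [r W]]] //; exists (b, r).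
have [[b o] [u [v [au uv W]]]] := dset_cover D_omin dW cA.
case: (bad_slope_nowhere uv _ W) => t ut _; apply: ca.
by move: au; rewrite gt_max => /andP[_]; move=> /lt_trans; apply.
Qed.

Lemma deriv_atP f t l : deriv_at f t l <-> is_derive t 1 f l.
Proof.
have E (h : R) : h != 0 -> l - h^-1 *: (f (h *: 1 + t) - f t) =
    - (h^-1 * (f (h + t) - f t - l * h)).
  by move=> h0; rewrite /GRing.scale /= mulr1; field.
have cvgE : deriv_at f t l <-> h^-1 *: (f (h *: 1 + t) - f t) @[h --> 0^'] -->
  l.
  split=> [fl|/cvgrPdist_le fl].
    apply/cvgrPdist_le => eps eps0; have [d [d0 dP]] := fl eps eps0.
    near=> h; have h0 : h != 0 by near: h; exact: nbhs_dnbhs_neq.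
    rewrite E // normrN normrM normfV ler_pdivrMl ?normr_gt0 // [leRHS]mulrC;
      apply: dP.
      by apply/eqP.
    by near: h; exact: dnbhs0_lt.
  move=> eps eps0; have /nbhs_ballP[d /= d0 dP] := fl eps eps0.
  exists d; split=> // h /eqP h0 hd.
  have := dP h; rewrite /ball /= sub0r normrN => /(_ hd h0).
  by rewrite E // normrN normrM normfV ler_pdivrMl ?normr_gt0 // [leRHS]mulrC.
rewrite cvgE; split=> [fl|[fd <-]].
  by split; [apply/cvg_ex; exists l|apply/cvg_lim].
exact: fd.
Unshelve. all: by end_near.
Qed.

(** The default value 0 makes this a total definable function; only its values near infinity
    matter. *)
Definition der f (t : R) : R :=
  if pselect (exists l, deriv_at f t l) is left h then projT1 (cid h) else 0.

Lemma derE f (t l : R) : is_derive t 1 f l -> der f t = l.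
Proof.
move=> fl; rewrite /der; case: pselect => [h|nh].
  have /deriv_atP fl' := projT2 (cid h).
  by rewrite -(@derive_val _ _ _ _ _ _ _ fl) -(@derive_val _ _ _ _ _ _ _ fl').
by case: nh; exists l; apply/deriv_atP.
Qed.

Lemma definable_der f : definable1 D f -> definable1 D (der f).
Proof.
move=> df; have dd := dfn_deriv_at df.
apply: (dfn_ext (P := fun e => deriv_at f (e 1%N) (e 0%N) \/
   (~ (exists l : R, deriv_at f (e 1%N) l) /\ e 0%N = 0))).
  move=> e; split.
    case=> [/deriv_atP /derE ->//|[nd ->]].
    by rewrite /der; case: pselect.
  rewrite /der; case: pselect => [h ->|nh ->]; last by right.
  by left; exact: (projT2 (cid h)).
apply: dfn_or => //; rewrite /deriv_at; definability.
Qed.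

Lemma der_near f : definable1 D f ->
  \forall t \near +oo, is_derive (t : R) 1 f (der f t).
Proof.
move=> /definable_eventually_deriv; apply: filterS => t [l fl].
by have /deriv_atP fl' := fl; rewrite (derE fl').
Qed.

End Differentiability.

(** * Growth of definable functions *)

Section RealAnalysis.
Context {R : realType}.
Implicit Types f g : R -> R.

Lemma is_derive_cont f (t l : R) : is_derive (t : R) 1 f l -> {for t,
  continuous f}.
Proof. by move=> [fd _]; apply/differentiable_continuous/derivable1_diffP. Qed.

Lemma mvt f df x y : x < y ->
  (forall t, x <= t -> t <= y -> is_derive (t : R) 1 f (df t)) ->
  exists c, [/\ x < c, c < y & f y - f x = df c * (y - x)].
Proof.
move=> xy fd; have [||c] := @MVT R f df x y xy.
- by move=> t; rewrite in_itv /= => /andP[xt ty]; apply: fd; apply: ltW.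
- apply: continuous_in_subspaceT => t; rewrite inE /= in_itv /= => /andP[xt ty].
  exact: is_derive_cont (fd t xt ty).
by rewrite in_itv /= => /andP[xc cy] fE; exists c.
Qed.

Lemma derive_nondecreasing f df x y : x <= y ->
  (forall t, x <= t -> t <= y -> is_derive (t : R) 1 f (df t)) ->
  (forall t, x <= t -> t <= y -> 0 <= df t) -> f x <= f y.
Proof.
rewrite le_eqVlt => /predU1P[->//|xy] fd df0.
have [c [xc cy E]] := mvt xy fd.
by rewrite -subr_ge0 E; apply: mulr_ge0; [apply: df0;
  exact: ltW|rewrite subr_ge0 ltW].
Qed.

Lemma derive_nonincreasing f df x y : x <= y ->
  (forall t, x <= t -> t <= y -> is_derive (t : R) 1 f (df t)) ->
  (forall t, x <= t -> t <= y -> df t <= 0) -> f y <= f x.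
Proof.
rewrite le_eqVlt => /predU1P[->//|xy] fd df0.
have [c [xc cy E]] := mvt xy fd.
by rewrite -subr_le0 E; apply: mulr_le0_ge0; [apply: df0;
  exact: ltW|rewrite subr_ge0 ltW].
Qed.

Lemma derive_lipschitz f df x y M s t :
  (forall r, x <= r -> r <= y -> is_derive (r : R) 1 f (df r)) ->
  (forall r, x <= r -> r <= y -> `|df r| <= M) ->
  x <= s -> s <= y -> x <= t -> t <= y -> `|f t - f s| <= M * (y - x).
Proof.
move=> fd dM.
have le p q : x <= p -> p < q -> q <= y -> `|f q - f p| <= M * (y - x).
  move=> xp pq qy; have [|r [pr rq ->]] := mvt (f := f) (df := df) pq.
    by move=> r pr rq; apply: fd; lra.
  have h := dM r ltac:(lra) ltac:(lra).
  rewrite normrM (gtr0_norm (_ : 0 < q - p)) ?subr_gt0 //.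
  apply: ler_pM => //; lra.
move=> xs sy xt ty; have [st|ts|->] := ltgtP s t; first exact: le.
  by rewrite distrC; exact: le.
rewrite subrr normr0; apply: mulr_ge0; last lra.
exact: le_trans (normr_ge0 _) (dM t xt ty).
Qed.

Lemma is_derive_div f g (t a b : R) : g t != 0 -> is_derive (t : R) 1 f a ->
  is_derive (t : R) 1 g b ->
  is_derive (t : R) 1 (fun s => f s / g s) ((a * g t - f t * b) / g t ^+ 2).
Proof.
move=> g0 fa gb; have gV := is_deriveV g0 gb.
apply: is_derive_eq (is_deriveM fa gV) _.
rewrite /GRing.scale /=; field; exact: g0.
Qed.

Lemma is_derive_inv f (t a : R) : f t != 0 -> is_derive (t : R) 1 f a ->
  is_derive (t : R) 1 (fun s => (f s)^-1) (- a / f t ^+ 2).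
Proof.
move=> f0 fa; apply: is_derive_eq (is_deriveV f0 fa) _.
by rewrite /GRing.scale /= mulNr mulrC mulNr.
Qed.

Lemma is_derive_X n (t : R) : is_derive t 1 (fun s : R =>
  s ^+ n) (n%:R * t ^+ n.-1).
Proof.
have -> : (fun s : R => s ^+ n) = id ^+ n by apply/funext => s;
  rewrite exprfctE.
apply: is_derive_eq (is_deriveX n (is_derive_id t 1)) _.
by rewrite /GRing.scale /= mulr1.
Qed.

Lemma is_derive_mulX f (t a : R) n : is_derive (t : R) 1 f a ->
  is_derive (t : R) 1 (fun s => f s * s ^+ n.+1)
    ((a * t + n.+1%:R * f t) * t ^+ n).
Proof.
move=> fa; have X : is_derive (t : R) 1 (fun s : R =>
  s ^+ n.+1) (n.+1%:R * t ^+ n).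
  exact: is_derive_X.
apply: is_derive_eq (is_deriveM fa X) _.
by rewrite /GRing.scale /= exprS; move: (t ^+ n) n.+1%:R => /= p q;
  change (f t * (q * p) + t * p * a = (a * t + q * f t) * p :> R); ring.
Qed.

Lemma is_derive_divX f (t a : R) n : 0 < t -> is_derive (t : R) 1 f a ->
  is_derive (t : R) 1 (fun s => f s / s ^+ n)
    ((a * t - n%:R * f t) / t ^+ n.+1).
Proof.
move=> t0 fa; have t0' : t != 0 by rewrite gt_eqF.
have X : is_derive (t : R) 1 (fun s : R => s ^+ n) (n%:R * t ^+ n.-1).
  exact: is_derive_X.
apply: is_derive_eq (is_derive_div (g := fun s =>
  s ^+ n) (expf_neq0 n t0') fa X) _.
case: n X => [|n] X; first by rewrite !mul0r expr0 mulr0 !subr0; field.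
by rewrite /= !exprS; field; rewrite t0' expf_neq0.
Qed.

Lemma near_and (P Q : R -> Prop) : (\forall t \near +oo, P t) ->
  (\forall t \near +oo, Q t) -> \forall t \near +oo, P t /\ Q t.
Proof. by move=> hP hQ; apply: filterS2 hP hQ. Qed.

Lemma near_gt (a : R) : \forall t \near +oo, a < t.
Proof. exact: nbhs_pinfty_gt (num_real a). Qed.

Lemma near_ex (P : R -> Prop) a : (\forall t \near +oo, P t) -> exists t,
  a < t /\ P t.
Proof.
move=> /(near_and (near_gt a)) /near_pinftyP[b bP]; exists (b + 1); apply: bP.
by rewrite ltrDl.
Qed.

End RealAnalysis.

(** * Bounds on the index t f'(t) / f(t) *)

Section Growth.
Unset Implicit Arguments.
Context {R : realType} {D : forall n : nat, set (set 'rV[R]_n)}.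
Set Implicit Arguments.
Context (D_omin : o_minimal_structure D) (D_pb : polynomially_bounded D).
Implicit Types f g : R -> R.

Lemma near_sign f : definable1 D f ->
  [\/ \forall t \near +oo, 0 < f t, \forall t \near +oo, f t < 0 |
      \forall t \near +oo, f t = 0].
Proof.
move=> df.
have d1 : dset D (fun t => 0 < f t) by definability.
have d2 : dset D (fun t => f t < 0) by definability.
have [p|np] := dset_pinfty D_omin d1; first by constructor 1.
have [n|nn] := dset_pinfty D_omin d2; first by constructor 2.
constructor 3; apply: filterS2 np nn => t /negP + /negP.
by rewrite -!leNgt => ? ?; apply/le_anti/andP.
Qed.

Lemma near_le_or_gt f g : definable1 D f -> definable1 D g ->
  (\forall t \near +oo, f t <= g t) \/ (\forall t \near +oo, g t < f t).
Proof.
move=> df dg; have d1 : dset D (fun t => f t <= g t) by definability.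
have [p|np] := dset_pinfty D_omin d1; first by left.
by right; apply: filterS np => t /negP; rewrite -ltNge.
Qed.

(** The limit is the supremum of the constants that [f] eventually exceeds; the infinite cases are
    those where this set is empty or unbounded. *)
Lemma definable_limit f : definable1 D f ->
  [\/ forall M, \forall t \near +oo, M < f t,
      forall M, \forall t \near +oo, f t < M |
      exists l, forall eps, 0 < eps -> \forall t \near +oo, `|f t - l| < eps].
Proof.
move=> df; pose S := [set q | \forall t \near +oo, q < f t].
have dc q : definable1 D (fun=> q) by definability.
have dec q : (\forall t \near +oo, f t <= q) \/ S q := near_le_or_gt df (dc q).
have [S0|/set0P/negP/negPn/eqP S0] := pselect (S !=set0); last first.
  constructor 2 => M; case: (dec (M - 1)) => [|SM].
    by apply: filterS => t; lra.
  by suff : set0 (M - 1) by []; rewrite -S0.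
have [ub|nub] := pselect (has_ubound S); last first.
  constructor 1 => M; case: (dec M) => // fM; case: nub; exists M => q Sq.
  have [t [_ [h1 h2]]] := near_ex 0 (near_and fM Sq); lra.
constructor 3; exists (sup S) => eps eps0.
have hS : has_sup S by [].
have [q Sq qs] := sup_adherent eps0 hS.
have [fl|Sl] := dec (sup S + eps / 2); last first.
  have := ub_le_sup ub Sl; lra.
apply: filterS2 Sq fl => t qt tl; rewrite ltr_norml; lra.
Qed.

Lemma definable_pb f : definable1 D f ->
  exists n (k : R), 0 < k /\ \forall t \near +oo, `|f t| <= k * t ^+ n.+1.
Proof.
move=> df; have [r [k hf]] : exists r k : R, \forall x \near +oo_R,
  `|f x| <= k * x `^ r.
  apply: D_pb; rewrite /definable_fun.
  have dG : dfn D (fun e => e 1%N = f (e 0%N)).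
    exact: (dfn_reindex D_omin (fun i => if i is 0 then 1%N else 0%N) df).
  have := dfn_supported D_omin (n := 2) _ dG.
  have -> : [set x : 'rV[R]_2 | pad x 1 = f (pad x 0)] =
      [set x : 'rV_2 | [set: R] (x 0 0) /\ x 0 1 = f (x 0 0)].
    by apply/seteqP; split=> x /=; rewrite (padE x 0) (padE x 1) //; case.
  by apply => e e' ee'; rewrite !ee'.
(* The real exponent is rounded up to the integer [n.+1], and [|k| + 1] is positive whatever the
   sign of [k]. *)
pose n := Num.trunc r; exists n, (`|k| + 1); split; first by rewrite ltr_wpDl.
apply: filterS2 hf (near_gt 1) => t hf t1; apply: le_trans hf _.
have tr : t `^ r <= t ^+ n.+1.
  by rewrite -powR_mulrn; [apply: ler_powR; rewrite ?ltW // truncnS_gt|lra].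
apply: le_trans (ler_wpM2r (powR_ge0 t r) (_ : k <= `|k| + 1)) _.
  by apply: le_trans (ler_norm k) _; rewrite lerDl.
by apply: ler_wpM2l tr; rewrite addr_ge0.
Qed.

Lemma index_upper f : definable1 D f -> (\forall t \near +oo, 0 < f t) ->
  exists n : nat, \forall t \near +oo, t * der f t <= n%:R * f t.
Proof.
move=> df f0; have ddf := definable_der D_omin df.
(* Here [|f| <= k t^(n+1)]. If eventually [t f' > (n+2) f], then [f / t^(n+2)] is nondecreasing,
   hence at least some [c > 0], although it is at most [k / t]. *)
have [n [k [k0 fk]]] := definable_pb df; exists n.+2.
have d1 : definable1 D (fun t => t * der f t) by definability.
have d2 : definable1 D (fun t => n.+2%:R * f t) by definability.
have [//|lt_nf] := near_le_or_gt d1 d2.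
have /near_pinftyP[a aP] := near_and (near_and f0 fk)
  (near_and lt_nf (der_near D_omin df)).
pose b := Num.max a 0 + 1.
have [ab b0] : a < b /\ 0 < b.
  have : a <= Num.max a 0 by rewrite le_max lexx.
  have : 0 <= Num.max a 0 by rewrite le_max lexx orbT.
  by rewrite /b; lra.
have up (t : R) : b <= t -> f b / b ^+ n.+2 <= f t / t ^+ n.+2.
  move=> bt; apply: (derive_nondecreasing (f :=
    fun s => f s / s ^+ n.+2) (df := fun s =>
    (der f s * s - n.+2%:R * f s) / s ^+ n.+3) bt).
    move=> s bs st; apply: is_derive_divX; first lra.
    by have [_ [_ fd]] := aP s ltac:(lra).
  move=> s bs st /=; have [_ [lt_s _]] := aP s ltac:(lra).
  by apply: divr_ge0; [by rewrite subr_ge0 [leRHS]mulrC ltW|apply: exprn_ge0;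
    lra].
have fb0 : 0 < f b by have [[]] := aP b ab.
pose c := f b / b ^+ n.+2; have c0 : 0 < c by rewrite divr_gt0 // exprn_gt0.
pose t := Num.max b (k / c + 1).
have bt : b <= t by rewrite le_max lexx.
have kt : k / c + 1 <= t by rewrite le_max lexx orbT.
have t0 : 0 < t by lra.
have [[_ ft] _] := aP t ltac:(lra).
have := up t bt; rewrite -/c ler_pdivlMr ?exprn_gt0 // => cft.
have : c * t <= k.
  rewrite -(ler_pM2r (exprn_gt0 n.+1 t0)) -mulrA -exprS.
  by apply: le_trans cft _; apply: le_trans (ler_norm _) ft.
have := kt; rewrite -(ler_pM2l c0) mulrDr mulrCA divff ?gt_eqF //; lra.
Qed.

Lemma near_derN f : definable1 D f ->
  \forall t \near +oo, der (fun s => - f s) t = - der f t.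
Proof.
move=> /(der_near D_omin); apply: filterS => t fd; exact: derE.
Qed.

Lemma near_derV f : definable1 D f -> (\forall t \near +oo, f t != 0) ->
  \forall t \near +oo, der (fun s => (f s)^-1) t = - der f t / f t ^+ 2.
Proof.
move=> /(der_near D_omin) fd f0; apply: filterS2 f0 fd => t f0 fd; apply: derE.
exact: is_derive_inv.
Qed.

Lemma index_bounded_pos f : definable1 D f -> (\forall t \near +oo, 0 < f t) ->
  exists n : nat, \forall t \near +oo, `|t * der f t| <= n%:R * f t.
Proof.
move=> df f0; have [n hn] := index_upper df f0.
have dV : definable1 D (fun t => (f t)^-1) by definability.
have V0 : \forall t \near +oo, 0 < (f t)^-1.
  by apply: filterS f0 => t; rewrite invr_gt0.
have f0' : \forall t \near +oo, f t != 0 by apply: filterS f0 => t /gt_eqF ->.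
have [m hm] := index_upper dV V0; exists (n + m)%N.
apply: filterS2 (near_and f0 hn) (near_and (near_derV df f0') hm) =>
  t [ft0 hn'] [-> hm'].
have : - (t * der f t) <= m%:R * f t.
  move: hm'; rewrite -(ler_pM2r (exprn_gt0 2 ft0)).
  have fn0 : f t != 0 by rewrite gt_eqF.
  have -> : t * (- der f t / f t ^+ 2) * f t ^+ 2 = - (t * der f t) by field.
  by have -> : m%:R * (f t)^-1 * f t ^+ 2 = m%:R * f t by field.
have n0 : 0 <= n%:R * f t by rewrite mulr_ge0 // ltW.
have m0 : 0 <= m%:R * f t by rewrite mulr_ge0 // ltW.
by rewrite natrD ler_norml; lra.
Qed.

Lemma index_bounded f : definable1 D f -> (\forall t \near +oo, f t != 0) ->
  exists n : nat, \forall t \near +oo, `|t * der f t| <= n%:R * `|f t|.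
Proof.
move=> df f0; case: (near_sign df) => [p|p|p].
- have [n hn] := index_bounded_pos df p; exists n.
  by apply: filterS2 p hn => t /gtr0_norm ->.
- have dN : definable1 D (fun t => - f t) by definability.
  have [|n hn] := index_bounded_pos dN _.
    by apply: filterS p => t; rewrite oppr_gt0.
  exists n; apply: filterS2 (near_and p hn) (near_derN df) =>
    t [/ltr0_norm ->] + E.
  by rewrite E mulrN normrN.
- have [t [_ [/eqP]]] := near_ex 0 (near_and f0 p); by [].
Qed.

(** The index bound in integrated form: for large [t], [|f| / t^n] is nonincreasing and [|f| t^n] is
    nondecreasing. *)
Lemma polynomial_growth f : definable1 D f -> (\forall t \near +oo, f t != 0) ->
  exists n (a : R), 0 < a /\ forall s t : R, a < s -> s <= t ->
    `|f t| * s ^+ n <= `|f s| * t ^+ n /\ `|f s| * s ^+ n <= `|f t| * t ^+ n.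
Proof.
have pos g : definable1 D g -> (\forall t \near +oo, 0 < g t) ->
    exists n (a : R), 0 < a /\ forall s t : R, a < s -> s <= t ->
    `|g t| * s ^+ n <= `|g s| * t ^+ n /\ `|g s| * s ^+ n <= `|g t| * t ^+ n.
  move=> dg g0; have [n hn] := index_bounded_pos dg g0.
  have /near_pinftyP[a aP] :=
    near_and (near_and g0 hn) (near_and (near_gt 0) (der_near D_omin dg)).
  exists n.+1, (Num.max a 1); split=> [|s t];
    first by rewrite lt_max ltr01 orbT.
  rewrite gt_max => /andP[sa s1] st.
  have g0' r : s <= r -> 0 < g r by move=> sr; have [[]] := aP r ltac:(lra).
  have gd r : s <= r -> is_derive (r : R) 1 g (der g r).
    by move=> sr; have [_ []] := aP r ltac:(lra).
  have gb r : s <= r -> `|r * der g r| <= n%:R * g r.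
    by move=> sr; have [[]] := aP r ltac:(lra).
  rewrite !gtr0_norm; [|exact: g0'|exact: g0'].
  have s0 : 0 < s by lra.
  have t0 : 0 < t by lra.
  split.
    rewrite -ler_pdivlMr ?exprn_gt0 // mulrAC -ler_pdivrMr ?exprn_gt0 //.
    apply: (derive_nonincreasing (f := fun s => g s / s ^+ n.+1) (df :=
      fun s => (der g s * s - n.+1%:R * g s) / s ^+ n.+2) st).
      by move=> r sr rt; apply: is_derive_divX; [lra|exact: gd].
    move=> r sr rt /=; rewrite mulr_le0_ge0 ?invr_ge0 ?exprn_ge0 //; last lra.
    have := gb r sr; have := g0' r sr; rewrite ler_norml -natr1; lra.
  apply: (derive_nondecreasing (f := fun s => g s * s ^+ n.+1) (df :=
    fun s => (der g s * s + n.+1%:R * g s) * s ^+ n) st).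
    by move=> r sr rt; apply: is_derive_mulX; exact: gd.
  move=> r sr rt /=; rewrite mulr_ge0 ?exprn_ge0 //; last lra.
  have := gb r sr; have := g0' r sr; rewrite ler_norml -natr1; lra.
move=> df f0; case: (near_sign df) => [p|p|p]; first exact: pos.
  have dN : definable1 D (fun t => - f t) by definability.
  have [|n [a [a0 aP]]] := pos _ dN.
    by apply: filterS p => t; rewrite oppr_gt0.
  by exists n, a; split=> // s t sa st; have := aP s t sa st; rewrite !normrN.
have [t [_ [/eqP]]] := near_ex 0 (near_and f0 p); by [].
Qed.

Lemma polynomial_lower_growth f b : definable1 D f ->
  (forall M, \forall t \near +oo, M < f t) ->
  (forall s t, b < s -> s < t -> f s < f t) ->
  exists n (k : R), 0 < k /\ \forall t \near +oo, t <= k * f t ^+ n.+1.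
Proof.
move=> df finf f_incr.
(* The inverse of [f] on []b, +oo[], set to 0 elsewhere to be a total function, as polynomial
   boundedness requires. *)
pose g y := if pselect (exists x, b < x /\ f x = y) is left h
  then projT1 (cid h) else 0.
have gf x : b < x -> g (f x) = x.
  move=> bx; rewrite /g; case: pselect => [h|[]]; last by exists x.
  case: (cid h) => z [bz fzx] /=.
  have [zx|xz|//] := ltgtP z x.
    by have := f_incr _ _ bz zx; rewrite fzx ltxx.
  by have := f_incr _ _ bx xz; rewrite fzx ltxx.
have dg : definable1 D g.
  apply: (dfn_ext (P := fun e => (exists x : R,
    b < x /\ f x = e 1%N /\ e 0%N = x) \/
    (~ (exists x : R, b < x /\ f x = e 1%N) /\ e 0%N = 0))).
    move=> e; split.
      case=> [[x [bx [<- ->]]]|[nx ->]]; first by rewrite gf.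
      by rewrite /g; case: pselect.
    move=> ge; have [h|h] := pselect (exists x, b < x /\ f x = e 1%N).
      by left; case: h => x [bx fx]; exists x; rewrite bx fx ge -fx gf.
    by right; split=> //; rewrite ge /g; case: pselect.
  by definability.
have [n [k [k0 /near_pinftyP[a aP]]]] := definable_pb dg.
exists n, k; split=> //; apply: filterS2 (finf a) (near_gt b) => t /aP h bt.
by apply: le_trans h; rewrite gf // ler_norm.
Qed.

Lemma index_lower_pos f : definable1 D f ->
  (forall M, \forall t \near +oo, M < f t) ->
  exists m, 0 < m /\ \forall t \near +oo, m * f t <= t * der f t.
Proof.
move=> df finf; have ddf := definable_der D_omin df.
have fd := der_near D_omin df.
(* An eventually nonpositive derivative would bound [f] from above. *)
have dpos : \forall t \near +oo, 0 < der f t.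
  have [//|np] : (\forall t \near +oo, 0 < der f t) \/ (\forall t \near +oo,
    der f t <= 0).
    case: (near_sign ddf) => h; first by left.
      by right; apply: filterS h => t /ltW.
    by right; apply: filterS h => t ->.
  have /near_pinftyP[a aP] := near_and np fd.
  have [t [at1 ft]] := near_ex (a + 1) (finf (f (a + 1))).
  suff : f t <= f (a + 1) by rewrite leNgt ft.
  apply: (derive_nonincreasing (df := der f)); first exact: ltW.
    by move=> s sa _; have [] := aP s ltac:(lra).
  by move=> s sa _; have [] := aP s ltac:(lra).
have /near_pinftyP[b bP] := near_and dpos fd.
have f_incr s t : b < s -> s < t -> f s < f t.
  move=> bs st; have [|c [sc ct E]] := mvt (f := f) (df := der f) st.
    by move=> r sr _; have [] := bP r ltac:(lra).
  rewrite -subr_gt0 E mulr_gt0 ?subr_gt0 //.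
  by have [] := bP c ltac:(lra).
have [n [k [k0 kf]]] := polynomial_lower_growth df finf f_incr.
(* If [N t f' < f] eventually, then [f^N / t] is nonincreasing, so [f^N <= (F c) t]. Squaring
   [t <= k f^(n+1)] gives [t^2 <= k^2 f^N <= k^2 (F c) t], false for large [t]. The exponent is
   doubled in order to gain this factor [t]. *)
pose N := (n.+1 + n.+1)%N.
have N0 : 0 < N%:R :> R by rewrite ltr0n.
exists N%:R^-1; split; first by rewrite invr_gt0.
have d1 : definable1 D (fun t => N%:R^-1 * f t) by definability.
have d2 : definable1 D (fun t => t * der f t) by definability.
have [//|small] := near_le_or_gt d1 d2.
have /near_pinftyP[a aP] := near_and (near_and (finf 0) kf) (near_and small fd).
pose c := Num.max a 0 + 1.
have [ac c0] : a < c /\ 0 < c.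
  have : a <= Num.max a 0 by rewrite le_max lexx.
  have : 0 <= Num.max a 0 by rewrite le_max lexx orbT.
  by rewrite /c; lra.
pose F s := f s ^+ N / s ^+ 1.
have down t : c <= t -> F t <= F c.
  move=> ct; pose dF s := (N%:R * f s ^+ N.-1 * der f s * s - 1%:R * f s ^+ N)
    / s ^+ 2.
  apply: (derive_nonincreasing (f := F) (df := dF) ct).
    move=> s cs st; apply: is_derive_divX; first lra.
    have [_ [_ fs]] := aP s ltac:(lra).
    have -> : (fun s => f s ^+ N) = f ^+ N by apply/funext => r;
      rewrite exprfctE.
    exact: is_derive_eq (is_deriveX N fs) _.
  move=> s cs st; have [[fs0 _] [sm _]] := aP s ltac:(lra).
  rewrite /dF mulr_le0_ge0 ?invr_ge0 ?exprn_ge0 //; last lra.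
  have -> : N%:R * f s ^+ N.-1 * der f s * s - 1%:R * f s ^+ N =
    f s ^+ N.-1 * (N%:R * (s * der f s) - f s).
    by rewrite -[in f s ^+ N](prednK (n := N)) // exprS; ring.
  rewrite mulr_ge0_le0 ?exprn_ge0 ?(ltW fs0) //.
  by rewrite subr_le0 -ler_pdivlMl // ltW.
have C0 : 0 < F c.
  by have [[fc _] _] := aP c ac; rewrite divr_gt0 // exprn_gt0.
pose t := Num.max c (k ^+ 2 * F c + 1).
have ct : c <= t by rewrite le_max lexx.
have kt : k ^+ 2 * F c + 1 <= t by rewrite le_max lexx orbT.
have t0 : 0 < t by lra.
have [[ft tk] _] := aP t ltac:(lra).
have tt : t * t <= k ^+ 2 * f t ^+ N.
  have -> : k ^+ 2 * f t ^+ N = (k * f t ^+ n.+1) * (k * f t ^+ n.+1).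
    by rewrite /N exprD; ring.
  by apply: ler_pM => //; apply: ltW.
have := down t ct; rewrite {1}/F ler_pdivrMr ?exprn_gt0 // => ftN.
have : t * t <= k ^+ 2 * F c * t.
  apply: le_trans tt _; rewrite -mulrA ler_pM2l ?exprn_gt0 //.
by rewrite ler_pM2r //; lra.
Qed.

Lemma index_lower_infinitesimal f : definable1 D f ->
  (\forall t \near +oo, f t != 0) ->
  (forall eps, 0 < eps -> \forall t \near +oo, `|f t| <= eps) ->
  exists m, 0 < m /\ \forall t \near +oo, m * `|f t| <= `|t * der f t|.
Proof.
have pos g : definable1 D g -> (\forall t \near +oo, 0 < g t) ->
  (forall eps, 0 < eps -> \forall t \near +oo, `|g t| <= eps) ->
  exists m, 0 < m /\ \forall t \near +oo, m * `|g t| <= `|t * der g t|.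
  move=> dg g0 gsmall.
  have dV : definable1 D (fun t => (g t)^-1) by definability.
  have g0' : \forall t \near +oo, g t != 0 by apply: filterS g0 => t /gt_eqF ->.
  have Vinf M : \forall t \near +oo, M < (g t)^-1.
    have M0 : 0 < `|M| + 1 by rewrite ltr_wpDl.
    have e0 : 0 < (`|M| + 1)^-1 by rewrite invr_gt0.
    apply: filterS2 g0 (gsmall _ e0) => t gt0; rewrite gtr0_norm // => gM.
    apply: lt_le_trans (_ : `|M| + 1 <= _); first by have := ler_norm M; lra.
    by rewrite -[leLHS]invrK lef_pV2.
  have [m [m0 hm]] := index_lower_pos dV Vinf; exists m; split=> //.
  apply: filterS2 (near_and g0 hm) (near_derV dg g0') => t [gt0 hm'] E.
  have gn0 : g t != 0 by rewrite gt_eqF.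
  rewrite gtr0_norm // -normrN; apply: le_trans (ler_norm _).
  move: hm'; rewrite E -(ler_pM2r (exprn_gt0 2 gt0)).
  have -> : t * (- der g t / g t ^+ 2) * g t ^+ 2 = - (t * der g t) by field.
  by have -> : m / g t * g t ^+ 2 = m * g t by field.
move=> df f0 fs; case: (near_sign df) => [p|p|p]; first exact: pos.
  have dN : definable1 D (fun t => - f t) by definability.
  have [|eps e0|m [m0 hm]] := pos _ dN.
  - by apply: filterS p => t; rewrite oppr_gt0.
  - by apply: filterS (fs _ e0) => t; rewrite normrN.
  exists m; split=> //; apply: filterS2 hm (near_derN df) => t + E.
  by rewrite E mulrN !normrN.
have [t [_ [/eqP]]] := near_ex 0 (near_and f0 p); by [].
Qed.

Lemma doubling f : definable1 D f -> (\forall t \near +oo, f t != 0) ->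
  exists a A : R, [/\ 0 < a, 1 <= A & forall T s t : R,
    a < T -> T <= s -> s <= 2 * T ->
    T <= t -> t <= 2 * T -> `|f s| <= A * `|f t|].
Proof.
move=> df f0; have [n [a [a0 aP]]] := polynomial_growth df f0.
(* Two points of [[T, 2T]] have ratio at most 2, to be raised to the exponent of
   [polynomial_growth]. *)
exists a, (2 ^+ n); split=> //; first by rewrite exprn_ege1 // ler1n.
move=> T s t aT Ts sT Tt tT.
have s0 : 0 < s by lra.
have t0 : 0 < t by lra.
have [st|/ltW ts] := leP s t.
  have [_ h] := aP s t ltac:(lra) st.
  rewrite -(ler_pM2r (exprn_gt0 n s0)); apply: le_trans h _.
  rewrite mulrAC -exprMn mulrC ler_wpM2r // lerXn2r ?nnegrE; lra.
have [h _] := aP t s ltac:(lra) ts.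
rewrite -(ler_pM2r (exprn_gt0 n t0)); apply: le_trans h _.
rewrite mulrAC -exprMn mulrC ler_wpM2r // lerXn2r ?nnegrE; lra.
Qed.

End Growth.

(** * Linear combinations of definable functions *)

Section Combinations.
Context {R : realType}.
Implicit Types (f : R -> R) (es : seq (R -> R)) (c : nat -> R).

Fixpoint every (T : Type) (P : T -> Prop) (s : seq T) : Prop :=
  if s is x :: s' then P x /\ every P s' else True.

Lemma every_imp (T : Type) (P Q : T -> Prop) s :
  (forall x, P x -> Q x) -> every P s -> every Q s.
Proof. by move=> PQ; elim: s => //= x s IH [/PQ Px /IH]. Qed.

Lemma every_and (T : Type) (P Q : T -> Prop) s :
  every P s -> every Q s -> every (fun x => P x /\ Q x) s.
Proof. by elim: s => //= x s IH [Px Ps] [Qx Qs]; split => //; apply: IH. Qed.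

Lemma every_map (T U : Type) (P : U -> Prop) (h : T -> U) s :
  every (fun x => P (h x)) s -> every P (map h s).
Proof. by elim: s => //= x s IH [Px /IH]. Qed.

Lemma every_near (T : Type) (P : T -> R -> Prop) s :
  every (fun x => \forall t \near +oo, P x t) s ->
  \forall t \near +oo, every (fun x => P x t) s.
Proof.
elim: s => [_|x s IH [Px /IH Ps]] /=; first by apply: filterS (near_gt 0).
exact: near_and.
Qed.

(** The coefficients form an infinite sequence whose first [size es] entries count, so that dropping
    the first function is a shift of the sequence. *)
Fixpoint lc es c (t : R) : R :=
  if es is e :: es' then c 0%N * e t + lc es' (fun i => c i.+1) t else 0.

Definition quot (e : R -> R) es := [seq (fun s => x s / e s) | x <- es].
Definition dquot (e : R -> R) es := map der (quot e es).

Lemma is_derive_lc es c (t : R) :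
  every (fun x => is_derive t 1 x (der x t)) es ->
  is_derive t 1 (lc es c) (lc (map der es) c t).
Proof.
elim: es c => [|x es IH] c /=; first by move=> _; exact: is_derive_cst.
move=> [dx /(IH (fun i => c i.+1)) ds].
exact: is_deriveD (is_deriveZ (c 0%N) dx) ds.
Qed.

Lemma lc_quot e es c t : e t != 0 -> lc es c t = e t * lc (quot e es) c t.
Proof.
move=> e0; elim: es c => [|x es IH] c /=; first by rewrite mulr0.
by rewrite IH; field.
Qed.

(* Some of the [2 ^ n] intervals may be reduced to a point. *)
Fixpoint pw n (P : R -> R -> Prop) x y : Prop :=
  if n is n'.+1 then exists m, [/\ x <= m, m <= y, pw n' P x m & pw n' P m y]
  else P x y.

Definition signed f x y : Prop :=
  (forall t, x <= t -> t <= y -> 0 <= f t) \/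
  (forall t, x <= t -> t <= y -> f t <= 0).

Definition monotone_on f x y : Prop :=
  (forall s t, x <= s -> s <= t -> t <= y -> f s <= f t) \/
  (forall s t, x <= s -> s <= t -> t <= y -> f t <= f s).

Lemma pw_refine n k P Q x y : x <= y ->
  (forall p q, x <= p -> p <= q -> q <= y -> P p q -> pw k Q p q) ->
  pw n P x y -> pw (n + k) Q x y.
Proof.
elim: n x y => [|n IH] x y xy PQ /=; first exact: PQ.
move=> [m [xm my P1 P2]]; exists m; split=> //; apply: IH => // p q h1 h2 h3.
  by apply: PQ => //; exact: le_trans h3 my.
by apply: PQ => //; exact: le_trans xm h1.
Qed.

(** At each of the [n] bisections, keep a part of at least half the length. *)
Lemma pw_large n P (x y : R) : x < y -> pw n P x y ->
  exists p q : R, [/\ x <= p, p < q, q <= y, P p q & y - x <= 2 ^+ n * (q - p)].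
Proof.
elim: n x y => [|n IH] x y xy /=.
  by move=> Pxy; exists x, y; rewrite expr0 mul1r !lexx.
move=> [m [xm my P1 P2]].
have [h|h] := leP (y - x) (2 * (m - x)).
  have [p [q [h1 h2 h3 h4 h5]]] := IH x m ltac:(lra) P1.
  by exists p, q; split=> //; rewrite ?exprS; lra.
have [p [q [h1 h2 h3 h4 h5]]] := IH m y ltac:(lra) P2.
by exists p, q; split=> //; rewrite ?exprS; lra.
Qed.

Lemma signed_monotone f df x y :
  (forall t, x <= t -> t <= y -> is_derive (t : R) 1 f (df t)) ->
  signed df x y -> monotone_on f x y.
Proof.
move=> fd [h|h]; [left|right] => s t xs st ty.
  apply: (derive_nondecreasing (df := df) st) => r sr rt.
    by apply: fd; lra.
  by apply: h; lra.
apply: (derive_nonincreasing (df := df) st) => r sr rt.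
  by apply: fd; lra.
by apply: h; lra.
Qed.

Lemma signed_point f x : signed f x x.
Proof.
have E t : x <= t -> t <= x -> t = x by move=> *; apply/le_anti/andP.
by have [h|h] := leP 0 (f x); [left|right] => t xt tx; rewrite (E t) // ltW.
Qed.

Lemma signedN f x y : signed (fun t => - f t) x y -> signed f x y.
Proof.
by case=> h; [right|left] => t xt ty; have := h t xt ty;
  rewrite ?oppr_ge0 ?oppr_le0.
Qed.

Lemma monotone_signed f x y : x <= y ->
  (forall t, x <= t -> t <= y -> {for t, continuous f}) ->
  monotone_on f x y -> pw 1 (signed f) x y.
Proof.
move=> xy; have incr g : (forall t, x <= t -> t <= y -> {for t,
  continuous g}) ->
    (forall s t, x <= s -> s <= t -> t <= y -> g s <= g t) -> pw 1 (signed g) x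
      y.
  move=> gc g_incr.
  have gw : {within `[x, y], continuous g}.
    apply: continuous_in_subspaceT => t; rewrite inE /= in_itv /= =>
      /andP[xt ty].
    exact: gc.
  (* Cut at a zero given by the intermediate value theorem. If [g] does not change sign, cut at an
     endpoint: the degenerate piece is signed by [signed_point]. *)
  suff [m [xm my h1 h2]] : exists m, [/\ x <= m, m <= y, x < m -> g m <= 0 &
      m < y -> 0 <= g m].
    exists m; split=> //.
      have [->|ne] := eqVneq x m; first exact: signed_point.
      right => t xt tm; apply: le_trans (g_incr _ _ xt tm my) _.
      by apply: h1; rewrite lt_neqAle ne.
    have [->|ne] := eqVneq m y; first exact: signed_point.
    left => t mt ty; apply: le_trans (g_incr _ _ xm mt ty).
    by apply: h2; rewrite lt_neqAle ne.
  have [x0|x0] := leP 0 (g x); first by exists x; rewrite ltxx lexx.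
  have [y0|y0] := leP (g y) 0; first by exists y; rewrite ltxx lexx.
  have [|m] := IVT xy gw (v := 0).
    by rewrite ge_min le_max (ltW x0) (ltW y0) orbT.
  by rewrite in_itv /= => /andP[xm my] gm; exists m; rewrite gm lexx.
move=> fc [f_incr|f_decr]; first exact: incr.
have [||m [xm my h1 h2]] := incr (fun t => - f t).
- by move=> t xt ty; apply: continuousN; exact: fc.
- by move=> s t xs st ty; rewrite lerN2; exact: f_decr.
by exists m; split=> //; apply: signedN.
Qed.

(** The mean value theorem on each outer third, of length [(q - p) / 3], gives a point where the
    slope is at most [2 B] over that length, whence the 6. Between these two points monotonicity
    keeps [dg] between its values there. *)
Lemma middle_third (g dg : R -> R) (p q B : R) : p < q ->
  (forall t, p <= t -> t <= q -> is_derive (t : R) 1 g (dg t)) ->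
  monotone_on dg p q -> (forall t, p <= t -> t <= q -> `|g t| <= B) ->
  exists u v : R, [/\ p <= u, u < v, v <= q, 3 * (v - u) = q - p &
    forall t, u <= t -> t <= v -> `|dg t| * (q - p) <= 6 * B].
Proof.
move=> pq gd gm gB.
pose u := p + (q - p) / 3; pose v := q - (q - p) / 3.
have [pu [uv vq]] : p < u /\ u < v /\ v < q by rewrite /u /v; lra.
have slope (x y : R) : p <= x -> x < y -> y <= q -> 3 * (y - x) = q - p ->
    exists r : R, [/\ x < r, r < y & `|dg r| * (q - p) <= 6 * B].
  move=> px xy yq xyE; have [|r [xr ry E]] := mvt (f := g) (df := dg) xy.
    by move=> t xt ty; apply: gd; lra.
  exists r; split=> //; rewrite -xyE.
  have -> : `|dg r| * (3 * (y - x)) = 3 * `|g y - g x|.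
    by rewrite E normrM (gtr0_norm (_ : 0 < y - x)) ?subr_gt0 //; ring.
  have := gB x ltac:(lra) ltac:(lra); have := gB y ltac:(lra) ltac:(lra).
  have := ler_normB (g y) (g x); lra.
have [r [pr ru rB]] := slope p u (lexx p) pu ltac:(lra) ltac:(rewrite /u; lra).
have [d [vd dq dB]] := slope v q ltac:(lra) vq (lexx q) ltac:(rewrite /v; lra).
exists u, v; split; [lra|lra|lra|by rewrite /u /v; lra|] => t ut tv.
have q0 : 0 < q - p by rewrite subr_gt0.
have pr' : p <= r by exact: ltW.
have dq' : d <= q by exact: ltW.
have rt : r <= t by exact: le_trans (ltW ru) ut.
have td : t <= d by exact: le_trans tv (ltW vd).
have pt : p <= t by exact: le_trans pr' rt.
have tq : t <= q by exact: le_trans td dq'.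
rewrite -ler_pdivlMr // in rB; rewrite -ler_pdivlMr // in dB;
  rewrite -ler_pdivlMr //.
move: rB dB; rewrite !ler_norml => /andP[r1 r2] /andP[d1 d2].
case: gm => gm.
  by rewrite (le_trans r1 (gm _ _ pr' rt tq)) (le_trans (gm _ _ pt td dq') d2).
by rewrite (le_trans d1 (gm _ _ pt td dq')) (le_trans (gm _ _ pr' rt tq) r2).
Qed.

End Combinations.

Section DefinableCombinations.
Unset Implicit Arguments.
Context {R : realType} {D : forall n : nat, set (set 'rV[R]_n)}.
Set Implicit Arguments.
Context (D_omin : o_minimal_structure D) (D_pb : polynomially_bounded D).
Implicit Types (f e : R -> R) (es : seq (R -> R)).

Lemma near_is_derive_lc es : every (definable1 D) es ->
  exists a, forall t c, a < t -> is_derive (t : R) 1 (lc es c)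
    (lc (map der es) c t).
Proof.
move=> des; have /every_near/near_pinftyP[a aP] :
  every (fun x => \forall t \near +oo, is_derive (t : R) 1 x (der x t)) es.
  by apply: every_imp des => x; exact: der_near.
by exists a => t c at_; apply/is_derive_lc/aP.
Qed.

Lemma every_der es : every (definable1 D) es -> every (definable1 D)
  (map der es).
Proof. by move=> des; apply: every_map; apply: every_imp des => x;
  exact: definable_der. Qed.

Lemma every_quot e es : definable1 D e -> every (definable1 D) es ->
  every (definable1 D) (quot e es).
Proof.
move=> de des; apply: every_map; apply: every_imp des => x dx; definability.
Qed.

(* With [G = lc (e :: es) c / e], differentiation removes the constant [c 0]. *)
Lemma divide_head e es : definable1 D e -> every (definable1 D) es ->
  (\forall t \near +oo, e t != 0) ->
  exists a, forall t c, a < t -> let G s := c 0%N + lc (quot e es) (fun i =>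
    c i.+1) s in
    [/\ e t != 0, lc (e :: es) c t = e t * G t &
     is_derive (t : R) 1 G (lc (dquot e es) (fun i => c i.+1) t)].
Proof.
move=> de des /near_pinftyP[a1 e0].
have [a2 qd] := near_is_derive_lc (every_quot de des).
exists (Num.max a1 a2) => t c; rewrite gt_max => /andP[/e0 et0 /qd h] G;
  split=> //.
  by rewrite /= (lc_quot _ _ et0) /G mulrDr [c 0%N * _]mulrC.
have := is_deriveD (is_derive_cst (c 0%N) t 1) (h (fun i => c i.+1)).
by rewrite add0r.
Qed.

(** Induction on the size, as [dquot e es] is shorter than [e :: es] but not a part of it. Where the
    derivative of [G = f / e] has a sign, [G] is monotone and one more cut gives it a sign; [e] has
    a constant sign near infinity. A head that vanishes near infinity is dropped. *)
Lemma piecewise_signed es : every (definable1 D) es ->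
  exists n (a : R), forall c (x y : R), a < x -> x <= y -> pw n (signed (lc es
    c)) x y.
Proof.
have [k] := ubnP (size es); elim: k es => // k IH [|e es] /=.
  by move=> _ _; exists 0%N, 0 => c x y _ _; left.
rewrite ltnS => sk [de des].
have [e0|[a1 e0]] : (\forall t \near +oo, e t != 0) \/ exists a, forall t,
  a < t -> e t = 0.
- case: (near_sign D_omin de) => h.
  + by left; apply: filterS h => t /gt_eqF ->.
  + by left; apply: filterS h => t /lt_eqF ->.
  + by right; apply/near_pinftyP.
- have [a1 hG] := divide_head de des e0.
  have dq : every (definable1 D) (dquot e es) by exact/every_der/every_quot.
  have [|n [a2 hn]] := IH (dquot e es) _ dq; first by rewrite !size_map.
  have [a3 se] : exists a, forall x y, a < x -> signed e x y.
    case: (near_sign D_omin de) => /near_pinftyP[a ha]; exists a => x y ax;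
      [left|right|left];
      move=> t xt ty; by [apply/ltW/ha; lra|rewrite ha //; lra].
  exists (n + 1)%N, (Num.max a1 (Num.max a2 a3)) => c x y.
  rewrite !gt_max => /and3P[x1 x2 x3] xy.
  apply: pw_refine (hn (fun i => c i.+1) x y x2 xy) => // p q xp pq qy sg.
  have Gd t : p <= t -> t <= q -> is_derive (t : R) 1
      (fun s => c 0%N + lc (quot e es) (fun i => c i.+1) s)
      (lc (dquot e es) (fun i => c i.+1) t).
    by move=> pt tq; have [] := hG t c ltac:(lra).
  apply: (pw_refine (n := 1) (k := 0) pq _ (monotone_signed pq _
    (signed_monotone Gd sg))).
    move=> p' q' pp' pq' qq' sG; change (signed (lc (e :: es) c) p' q').
    have fE t : p' <= t -> t <= q' -> lc (e :: es) c t =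
        e t * (c 0%N + lc (quot e es) (fun i => c i.+1) t).
      by move=> pt tq; have [] := hG t c ltac:(lra).
    case: (se p' q' ltac:(lra)) => he; case: sG => hg;
      [left|right|right|left] => t pt tq;
      rewrite fE //; have := he t pt tq; have := hg t pt tq => h1 h2.
    - exact: mulr_ge0.
    - exact: mulr_ge0_le0.
    - exact: mulr_le0_ge0.
    - exact: mulr_le0.
  by move=> t pt tq; exact: is_derive_cont (Gd t pt tq).
have [n [a2 hn]] := IH es sk des.
exists n, (Num.max a1 a2) => c x y; rewrite gt_max => /andP[x1 x2] xy.
rewrite -[n]addn0; apply: (pw_refine (k := 0) (n :=
  n) xy _ (hn (fun i => c i.+1) x y x2 xy)) => p q xp pq qy.
by case=> h; [left|right] => t pt tq; rewrite /= e0 ?mulr0 ?add0r;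
  [exact: h|lra|exact: h|lra].
Qed.

(** A bound on [f] passes to [G = f / e] by [doubling], but to [G'] only where [G'] is monotone and
    away from the ends: on the middle third of a long interval where [G''] has a sign. Its length
    remains proportional to that of [[u, v]]. *)
Lemma derivative_small e es : definable1 D e -> every (definable1 D) es ->
  (\forall t \near +oo, e t != 0) ->
  exists a K : R, [/\ 0 < a, 0 < K & forall c (T u v B : R),
    a < T -> T <= u -> u < v -> v <= 2 * T ->
    (forall t, u <= t -> t <= v -> `|lc (e :: es) c t| <= B) ->
    exists u' v' : R, [/\ u <= u', u' < v', v' <= v, v - u <= K * (v' - u') &
      forall t, u' <= t -> t <= v' ->
        `|lc (dquot e es) (fun i => c i.+1) t| <= K * (B / `|e T|) / (v - u)]].
Proof.
move=> de des e0.
have dq : every (definable1 D) (dquot e es) by exact/every_der/every_quot.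
have [a1 hG] := divide_head de des e0.
have [a2 dG] := near_is_derive_lc dq.
have [n [a3 hpw]] := piecewise_signed (every_der dq).
have [a4 [A [a40 A1 hA]]] := doubling D_omin D_pb de e0.
have X0 : 0 < 2 ^+ n :> R by rewrite exprn_gt0.
(* [6] is the constant of [middle_third], [2 ^+ n] the loss of length in [pw_large], [A] the
   variation of [e]; the ratio of lengths would only need [3 * 2 ^+ n]. *)
pose K : R := 6 * 2 ^+ n * A.
have K0 : 0 < K by rewrite !mulr_gt0 //; lra.
exists (Num.max (Num.max a1 a2) (Num.max a3 a4)), K; split=> //.
  by rewrite !lt_max a40 !orbT.
move=> c T u v B; rewrite !gt_max => /andP[/andP[Ta1 Ta2] /andP[Ta3 Ta4]] Tu uv
  vT fB.
set c' := fun i => c i.+1.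
have eT0 : 0 < `|e T| by rewrite normr_gt0; have [] := hG T c Ta1.
pose B1 := A * (B / `|e T|).
have GB t : u <= t -> t <= v -> `|c 0%N + lc (quot e es) c' t| <= B1.
  move=> ut tv; have [et0 fE _] := hG t c ltac:(lra).
  have := fB t ut tv; rewrite fE normrM => h.
  rewrite /B1 mulrA ler_pdivlMr // mulrC.
  apply: le_trans (_ : A * `|e t| * `|c 0%N + lc (quot e es) c' t| <= _).
    apply: ler_wpM2r => //; apply: (hA T) => //.
    - by rewrite mulr_natl mulr2n lerDl (ltW (lt_trans a40 Ta4)).
    - exact: le_trans Tu ut.
    - exact: le_trans tv vT.
  by rewrite -mulrA ler_wpM2l // (le_trans ler01 A1).
have [p [q [up pq qv sg len]]] := pw_large uv (hpw c' u v ltac:(lra)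
  ltac:(lra)).
have mG : monotone_on (lc (dquot e es) c') p q.
  by apply: signed_monotone sg => t pt tq; apply: dG; lra.
have [||u' [v' [pu' uv' vq' len' dB]]] := middle_third pq _ mG (B := B1)
    (g := fun s => c 0%N + lc (quot e es) c' s).
- by move=> t pt tq; have [] := hG t c ltac:(lra).
- by move=> t pt tq; apply: GB; lra.
exists u', v'; split=> //; [exact: le_trans pu'|exact: le_trans vq' qv| |].
  have h : v - u <= 2 ^+ n * (3 * (v' - u')) by rewrite len'.
  apply: le_trans h _; rewrite /K mulrA ler_pM2r ?subr_gt0 //.
  have : 2 ^+ n * 1 <= 2 ^+ n * A by rewrite ler_pM2l.
  lra.
move=> t ut tv; rewrite ler_pdivlMr ?subr_gt0 //.
apply: le_trans (ler_wpM2l (normr_ge0 _) len) _.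
rewrite mulrCA; apply: le_trans (_ : 2 ^+ n * (6 * B1) <= _).
  by rewrite ler_pM2l //; exact: dB.
by rewrite /K /B1; lra.
Qed.

End DefinableCombinations.

Section Remez.
Unset Implicit Arguments.
Context {R : realType} {D : forall n : nat, set (set 'rV[R]_n)}.
Set Implicit Arguments.
Context (D_omin : o_minimal_structure D) (D_pb : polynomially_bounded D).
Implicit Types (f e : R -> R) (es : seq (R -> R)).

(* A Remez inequality on intervals of bounded ratio, by induction on the number
   of functions: dividing by the first one and differentiating removes it. *)
Lemma local_remez es : every (definable1 D) es ->
  exists (a C : R) N, [/\ 0 < a, 0 <= C & forall c (T x y u v B : R),
    a < T -> T <= x -> x <= u ->
    u < v -> v <= y -> y <= 2 * T ->
    (forall t, u <= t -> t <= v -> `|lc es c t| <= B) ->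
    forall t, x <= t -> t <= y -> `|lc es c t| <= C * ((y - x) / (v - u)) ^+ N
      * B].
Proof.
have [k] := ubnP (size es); elim: k es => // k IH [|e es].
  move=> _ _; exists 1, 0, 0%N; split=> // c T x y u v B *.
  by rewrite normr0 !mul0r.
rewrite ltnS => sk [de des].
have [e0|[a1 e0]] : (\forall t \near +oo, e t != 0) \/ exists a, forall t,
  a < t -> e t = 0.
- case: (near_sign D_omin de) => h.
  + by left; apply: filterS h => t /gt_eqF ->.
  + by left; apply: filterS h => t /lt_eqF ->.
  + by right; apply/near_pinftyP.
- have [a1 hG] := divide_head D_omin de des e0.
  have dq : every (definable1 D) (dquot e es) by apply: every_der => //;
    apply: every_quot.
  have [|a2 [C [N [a20 C0 hL]]]] := IH (dquot e es) _ dq;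
    first by rewrite !size_map.
  have [a3 [K [a30 K0 hK]]] := derivative_small D_omin D_pb de des e0.
  have [a4 [A [a40 A1 hA]]] := doubling D_omin D_pb de e0.
  (* The induction hypothesis extends the bound on [G'] from [[u', v']] to [[x, y]]. The ratio of
     lengths is at most [K] times [r = (y - x) / (v - u)], whence [K ^+ N]; the last [K] is in the
     bound on [[u', v']]. *)
  pose C1 := C * K ^+ N * K.
  have C10 : 0 <= C1 by rewrite !mulr_ge0 ?exprn_ge0 // ltW.
  (* Passing from [G'] back to [G], starting at [u], costs one more power of the ratio, hence
     [N.+1]. One [A] comes from bounding [G u] by means of [B], the other from
     [|e t| <= A |e T|]. *)
  exists (Num.max (Num.max a1 a2) (Num.max a3 a4)), (A * A * (1 + C1) : R),
    N.+1; split.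
  + by rewrite !lt_max a40 !orbT.
  + have A0 : 0 <= A by exact: le_trans A1.
    by rewrite !mulr_ge0 // addr_ge0.
  move=> c T x y u v B; rewrite !gt_max => /andP[/andP[Ta1 Ta2] /andP[Ta3 Ta4]]
    Tx xu uv vy yT fB.
  set c' := fun i => c i.+1; pose G s := c 0%N + lc (quot e es) c' s.
  pose E := `|e T|.
  have E0 : 0 < E by rewrite normr_gt0; have [] := hG T c Ta1.
  have xy : x <= y by exact: le_trans xu (le_trans (ltW uv) vy).
  have T0 : 0 < T by exact: lt_trans a40 Ta4.
  have TT : T <= 2 * T by rewrite mulr_natl mulr2n lerDl ltW.
  have a1_lt s : x <= s -> a1 < s by move=> xs;
    exact: lt_le_trans Ta1 (le_trans Tx xs).
  have e_le s : x <= s -> s <= y -> `|e s| <= A * E.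
    by move=> xs sy; apply: (hA T) => //; [exact: le_trans xs|exact: le_trans
      yT].
  have e_ge s : x <= s -> s <= y -> E <= A * `|e s|.
    by move=> xs sy; apply: (hA T) => //; [exact: le_trans xs|exact: le_trans
      yT].
  have uy : u <= y by exact: le_trans (ltW uv) vy.
  have A0 : 0 <= A by exact: le_trans A1.
  have [u' [v' [uu' uv' vv' len dB]]] :=
    hK c T u v B Ta3 (le_trans Tx xu) uv (le_trans vy yT) fB.
  have dB' := hL c' T x y u' v' _ Ta2 Tx (le_trans xu uu') uv' (le_trans vv'
    vy) yT dB.
  pose r := (y - x) / (v - u).
  have vu0 : 0 < v - u by rewrite subr_gt0.
  have r1 : 1 <= r by rewrite ler_pdivlMr // mul1r lerB.
  have r0 : 0 <= r by exact: le_trans r1.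
  have B0 : 0 <= B by apply: le_trans (normr_ge0 _) (fB u _ _) => //;
    exact: ltW.
  have BE0 : 0 <= B / E by rewrite divr_ge0 // ltW.
  have dB'' t : x <= t -> t <= y ->
      `|lc (dquot e es) c' t| <= C1 * r ^+ N * (B / E) / (v - u).
    move=> xt ty; apply: le_trans (dB' t xt ty) _.
    have -> : C1 * r ^+ N * (B / E) / (v - u) =
        C * (K * r) ^+ N * (K * (B / E) / (v - u)) by rewrite /C1 (exprMn N K
          r); move: (K ^+ N) (r ^+ N) (B / E) (v - u)^-1 => w1 w2 w3 w4; ring.
    apply: ler_wpM2r; first by rewrite divr_ge0 ?mulr_ge0 // ltW.
    apply: ler_wpM2l => //; rewrite lerXn2r ?nnegrE //.
    * by rewrite divr_ge0 ?subr_ge0 // ltW.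
    * by rewrite mulr_ge0 // ltW.
    rewrite ler_pdivrMr ?subr_gt0 // /r mulrA mulrAC ler_pdivlMr //.
    by rewrite mulrAC [leRHS]mulrC ler_wpM2l // subr_ge0.
  move=> t xt ty.
  have Gt : `|G t| <= A * (1 + C1) * r ^+ N.+1 * (B / E).
    have Gu : `|G u| <= A * (B / E).
      have [eu0 fE _] := hG u c (a1_lt u xu).
      have := fB u (lexx u) (ltW uv); rewrite fE normrM -/c' -/(G u) => h.
      rewrite mulrA ler_pdivlMr // mulrC.
      apply: le_trans (_ : A * `|e u| * `|G u| <= _).
        by apply: ler_wpM2r => //; exact: e_ge.
      by rewrite -mulrA ler_wpM2l.
    have lip : `|G t - G u| <= C1 * r ^+ N * (B / E) / (v - u) * (y - x).
      apply: (derive_lipschitz (df := lc (dquot e es) c') (x := x) (y :=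
        y)) => //.
      by move=> s xs sy; have [] := hG s c (a1_lt s xs).
    have lipE : C1 * r ^+ N * (B / E) / (v - u) * (y - x) = C1 * r ^+ N.+1 * (B
      / E).
      by rewrite exprS {2}/r; move: (r ^+ N) (B / E) (v - u)^-1 => w1 w2 w3;
        ring.
    have r1' : 1 <= r ^+ N.+1 by rewrite exprn_ege1.
    have h1 : A * (B / E) * 1 <= A * (B / E) * r ^+ N.+1.
      by apply: ler_wpM2l => //; apply: mulr_ge0.
    have h2 : 1 * (C1 * r ^+ N.+1 * (B / E)) <= A * (C1 * r ^+ N.+1 * (B / E)).
      by apply: ler_wpM2r => //; apply: mulr_ge0 => //; apply: mulr_ge0 => //;
        exact: exprn_ge0.
    rewrite -[G t](subrK (G u)); apply: le_trans (ler_normD _ _) _.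
    apply: le_trans (lerD lip Gu) _; rewrite lipE.
    clear -h1 h2; move: (r ^+ N.+1) (B / E) h1 h2 => w1 w2; lra.
  have [et0 fE _] := hG t c (a1_lt t xt).
  rewrite fE normrM -/c' -/(G t).
  have et : `|e t| <= A * E by exact: e_le.
  apply: le_trans (ler_pM _ _ et Gt) _ => //.
  have -> : A * E * (A * (1 + C1) * r ^+ N.+1 * (B / E)) =
     A * A * (1 + C1) * r ^+ N.+1 * B * (E / E).
    by move: (r ^+ N.+1) E^-1 => w1 w2; ring.
  by rewrite divff ?mulr1 ?gt_eqF.
have [a2 [C [N [a20 C0 hL]]]] := IH es sk des.
exists (Num.max a1 a2), C, N; split=> //; first by rewrite lt_max a20 orbT.
move=> c T x y u v B; rewrite gt_max => /andP[T1 T2] Tx xu uv vy yT fB t xt ty.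
rewrite /= e0 ?mulr0 ?add0r; last exact: lt_le_trans (lt_le_trans T1 Tx) xt.
apply: (hL (fun i => c i.+1) T x y u v B) => // s us sv.
have := fB s us sv; rewrite /= e0 ?mulr0 ?add0r //.
exact: lt_le_trans (lt_le_trans T1 Tx) (le_trans xu us).
Qed.

End Remez.

(** * Functions of distinct orders of growth *)

Section Scales.
Unset Implicit Arguments.
Context {R : realType} {D : forall n : nat, set (set 'rV[R]_n)}.
Set Implicit Arguments.
Context (D_omin : o_minimal_structure D) (D_pb : polynomially_bounded D).
Implicit Types (f e x y : R -> R) (es : seq (R -> R)) (c : nat -> R).

Definition oo f e : Prop :=
  forall eps, 0 < eps -> \forall t \near +oo, `|f t| <= eps * `|e t|.

Fixpoint chain es : Prop :=
  if es is e :: es' then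
    [/\ definable1 D e, \forall t \near +oo, e t != 0, every (fun x =>
      oo x e) es' &
        chain es']
  else True.

Lemma oo_trans f g e : oo f g -> oo g e -> oo f e.
Proof.
move=> fg ge eps eps0; apply: filterS2 (fg _ eps0) (ge _ ltr01) => t h1.
by rewrite mul1r => h2; apply: le_trans h1 _; rewrite ler_pM2l.
Qed.

Lemma oo_comb f g e a : oo f e -> oo g e -> oo (fun t => f t + a * g t) e.
Proof.
move=> fe ge eps eps0.
have k0 : 0 < `|a| + 1 by rewrite ltr_wpDl.
have e1 : 0 < eps / 2 by rewrite divr_gt0.
have e2 : 0 < eps / 2 / (`|a| + 1) by rewrite divr_gt0.
apply: filterS2 (fe _ e1) (ge _ e2) => t h1 h2.
apply: le_trans (ler_normD _ _) _; rewrite normrM.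
have : (`|a| + 1) * `|g t| <= eps / 2 * `|e t|.
  have -> : eps / 2 * `|e t| = (`|a| + 1) * (eps / 2 / (`|a| + 1) * `|e t|).
    by move: k0 `|e t| => k0 w; field; rewrite gt_eqF.
  by rewrite ler_pM2l.
have := normr_ge0 (g t); move: `|f t| `|g t| `|e t| `|a| h1 => *; lra.
Qed.

Lemma every_chain es : chain es ->
  every (fun x => definable1 D x /\ \forall t \near +oo, x t != 0) es.
Proof. by elim: es => //= e es IH [de e0 _ /IH]. Qed.

Lemma chain_definable es : chain es -> every (definable1 D) es.
Proof. by move=> /every_chain; apply: every_imp => x []. Qed.

Lemma oo_quot f e : (\forall t \near +oo, e t != 0) -> oo f e ->
  forall eps, 0 < eps -> \forall t \near +oo, `|f t / e t| <= eps.
Proof.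
move=> e0 fe eps eps0; apply: filterS2 e0 (fe _ eps0) => t et0 h.
by rewrite normrM normfV ler_pdivrMr // normr_gt0.
Qed.

Lemma oo_div f g e : (\forall t \near +oo, e t != 0) -> oo f g ->
  oo (fun t => f t / e t) (fun t => g t / e t).
Proof.
move=> e0 fg eps eps0; apply: filterS2 e0 (fg _ eps0) => t et0 h.
by rewrite !normrM normfV mulrA ler_wpM2r.
Qed.

(** In general derivation does not preserve little-o. Here [t f' = O(f)] by the index bound and
    [g = O(t g')] because [g] tends to 0, so [f = o(g)] yields [t f' = o(t g')]. *)
Lemma oo_der f g : definable1 D f -> (\forall t \near +oo, f t != 0) ->
  definable1 D g -> (\forall t \near +oo, g t != 0) ->
  (forall eps, 0 < eps -> \forall t \near +oo, `|g t| <= eps) ->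
  oo f g -> oo (der f) (der g).
Proof.
move=> df f0 dg g0 gs fg eps eps0.
have [n hn] := index_bounded D_omin D_pb df f0.
have [m [m0 hm]] := index_lower_infinitesimal D_omin D_pb dg g0 gs.
have n0 : 0 < n%:R + 1 :> R by rewrite ltr_wpDl.
have e0 : 0 < eps * m / (n%:R + 1) by rewrite divr_gt0 // mulr_gt0.
apply: filterS2 (near_and hn hm) (near_and (fg _ e0) (near_gt 0)) =>
  t [h1 h2] [h3 t0].
move: h1 h2; rewrite !normrM (gtr0_norm t0) => h1 h2.
rewrite -(ler_pM2l t0); apply: le_trans h1 _.
apply: le_trans (_ : (n%:R + 1) * `|f t| <= _).
  by apply: ler_wpM2r => //; rewrite lerDl.
rewrite mulrC -ler_pdivlMr //; apply: le_trans h3 _.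
rewrite mulrAC ler_pM2r ?invr_gt0 // -mulrA [leRHS]mulrCA.
by rewrite ler_pM2l.
Qed.

Lemma near_der_neq0 f : definable1 D f -> (\forall t \near +oo, f t != 0) ->
  (forall eps, 0 < eps -> \forall t \near +oo, `|f t| <= eps) ->
  \forall t \near +oo, der f t != 0.
Proof.
move=> df f0 fs; have [m [m0 hm]] := index_lower_infinitesimal D_omin D_pb df
  f0 fs.
apply: filterS2 f0 hm => t ft0; apply: contraTneq => ->.
by rewrite mulr0 normr0 -ltNge mulr_gt0 // normr_gt0.
Qed.

(** After division by the head all quotients tend to 0, which is what [oo_der] and [near_der_neq0]
    require. *)
Lemma chain_dquot e es : chain (e :: es) -> chain (dquot e es).
Proof.
move=> [de e0 ese ces].
elim: es ese ces => //= x es IH [xe ese] [dx x0 esx ces].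
have dq y : definable1 D y -> definable1 D (fun t => y t / e t).
  by move=> dy; definability.
have q0 y : (\forall t \near +oo, y t != 0) -> \forall t \near +oo,
  y t / e t != 0.
  by move=> y0; apply: filterS2 y0 e0 => t yt et; rewrite mulf_neq0 ?invr_neq0.
split; [exact/definable_der/dq| | |exact: IH].
  by apply: near_der_neq0; [exact: dq|exact: q0|exact: oo_quot].
apply/every_map/every_map.
apply: every_imp (every_and (every_chain ces) (every_and ese esx)) =>
  y [[dy y0] [ye yx]].
by apply: oo_der; [exact: dq|exact: q0|exact: dq|exact: q0|exact:
  oo_quot|exact: oo_div].
Qed.

Fixpoint terms_le es c (T M : R) : Prop :=
  if es is e :: es' then `|c 0%N * e T| <= M /\ terms_le es' (fun i =>
    c i.+1) T M
  else True.

Lemma terms_leW es c T M M' : M <= M' -> terms_le es c T M -> terms_le es c T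
  M'.
Proof.
move=> MM'; elim: es c => //= e es IH c [h1 h2]; split; last exact: IH.
exact: le_trans h1 MM'.
Qed.

Lemma lc_terms_le es c T M : terms_le es c T M -> `|lc es c T| <= (size es)%:R
  * M.
Proof.
elim: es c => [|e es IH] c /=; first by rewrite normr0 mul0r.
move=> [h1 /IH h2]; apply: le_trans (ler_normD _ _) _.
by rewrite -[_.+1%:R]natr1 mulrDl mul1r addrC lerD.
Qed.

(** With one constant for the whole list, this recovers each term of a combination from the
    corresponding term of its differentiated quotient. *)
Lemma quot_index e es : chain (e :: es) -> exists m, 0 < m /\
  \forall t \near +oo, every (fun x => m * `|x t / e t| <= `|t * der (fun s =>
    x s / e s) t|) es.
Proof.
move=> [de e0 ese ces]; elim: es ese ces => [_ _|x es IH] /=.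
  by exists 1; split => //; apply: filterS (near_gt 0).
move=> [xe ese] [dx x0 _ ces].
have dq : definable1 D (fun t => x t / e t) by definability.
have q0 : \forall t \near +oo, x t / e t != 0.
  by apply: filterS2 x0 e0 => t xt et; rewrite mulf_neq0 ?invr_neq0.
have [m1 [m10 h1]] := index_lower_infinitesimal D_omin D_pb dq q0 (oo_quot e0
  xe).
have [m2 [m20 h2]] := IH ese ces.
exists (Num.min m1 m2); split; first by rewrite lt_min m10.
apply: filterS2 h1 h2 => t h1 h2; split.
  by apply: le_trans h1; apply: ler_wpM2r => //; rewrite ge_min lexx.
apply: every_imp h2 => y; apply: le_trans.
by apply: ler_wpM2r => //; rewrite ge_min lexx orbT.
Qed.

(* No cancellation between the terms of a combination of functions of distinct
   orders of growth, on intervals [T, 2T]. *)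
Lemma chain_terms_le es : chain es ->
  exists a C : R, [/\ 0 < a, 0 <= C & forall c (T B : R), a < T ->
    (forall t, T <= t -> t <= 2 * T -> `|lc es c t| <= B) -> terms_le es c T (C
      * B)].
Proof.
have [k] := ubnP (size es); elim: k es => // k IH [|e es].
  by move=> _ _; exists 1, 0; split.
rewrite ltnS => sk ch; have [de e0 ese ces] := ch.
have des := chain_definable ces.
have cdq := chain_dquot ch; have dq := chain_definable cdq.
have [|a1 [C1 [a10 C10 hQ]]] := IH (dquot e es) _ cdq;
  first by rewrite !size_map.
have [a2 [C2 [N [a20 C20 hL]]]] := local_remez D_omin D_pb dq.
have [a3 [K [a30 K0 hK]]] := derivative_small D_omin D_pb de des e0.
have [m [m0 /(near_and e0)/near_pinftyP[a4 hm]]] := quot_index ch.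
(* For the terms after the first: the parenthesis bounds [G'] on [[T, 2T]] from the subinterval of
   [hK], [C1] separates its terms by the induction hypothesis, and [m] undoes the derivation of each
   quotient. *)
pose C3 := C1 * (C2 * K ^+ N * K) / m.
have C30 : 0 <= C3.
  by apply: divr_ge0; [do 3?apply: mulr_ge0|]; rewrite ?exprn_ge0 // ltW.
exists (Num.max (Num.max a1 a2) (Num.max a3 a4)), (1 + (size es).+1%:R * C3);
  split.
- by rewrite !lt_max a10.
- by apply: addr_ge0 => //; apply: mulr_ge0.
move=> c T B; rewrite !gt_max => /andP[/andP[Ta1 Ta2] /andP[Ta3 Ta4]] fB.
set c' := fun i => c i.+1.
have T0 : 0 < T by apply: lt_trans Ta1.
have T2 : T < 2 * T by lra.
have [eT0 hmT] := hm T Ta4.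
have E0 : 0 < `|e T| by rewrite normr_gt0.
have B0 : 0 <= B by apply: le_trans (fB T _ _) => //; exact: ltW.
have [u' [v' [uu' uv' vv' len dB]]] := hK c T T (2 * T) B Ta3 (lexx _) T2 (lexx
  _) fB.
have TE : 2 * T - T = T by ring.
rewrite TE in len dB.
have dB' := hL c' T T (2 * T) u' v' _ Ta2 (lexx _) uu' uv' vv' (lexx _) dB.
have tdq := hQ c' T _ Ta1 dB'; rewrite TE in tdq.
have tq : terms_le es c' T (C3 * B).
  have bound : C1 * (C2 * (T / (v' - u')) ^+ N * (K * (B / `|e T|) / T)) <=
      C1 * (C2 * K ^+ N * K) * B / (`|e T| * T).
    have -> : C1 * (C2 * K ^+ N * K) * B / (`|e T| * T) =
        C1 * (C2 * K ^+ N * (K * (B / `|e T|) / T)).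
      by rewrite invfM; move: (K ^+ N) `|e T|^-1 T^-1 => w1 w2 w3; ring.
    apply: ler_wpM2l => //; apply: ler_wpM2r.
      by rewrite divr_ge0 ?mulr_ge0 ?divr_ge0 // ltW.
    apply: ler_wpM2l => //; rewrite lerXn2r ?nnegrE ?(ltW K0) //.
      by rewrite divr_ge0 ?subr_ge0 // ltW.
    by rewrite ler_pdivrMr ?subr_gt0.
  have {}tdq := terms_leW bound tdq; clear -tdq hmT m0 E0 T0 eT0.
  rewrite /C3; set M := C1 * _ in tdq *.
  elim: es c' tdq hmT => //= x es IH c' [h1 h2] [k1 k2]; split; last exact: IH.
  have -> : c' 0%N * x T = c' 0%N * (x T / e T) * e T by rewrite -!mulrA mulVf
    // mulr1.
  rewrite !normrM; set d := der _ T in h1 k1; move: h1 k1;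
    rewrite !normrM (gtr0_norm T0) => h1 k1.
  have k1' : `|x T| * `|(e T)^-1| <= T * `|d| / m by rewrite ler_pdivlMr //
    mulrC.
  apply: le_trans (_ : `|c' 0%N| * (T * `|d| / m) * `|e T| <= _).
    by rewrite ler_pM2r // ler_wpM2l.
  have -> : `|c' 0%N| * (T * `|d| / m) * `|e T| = `|c' 0%N| * `|d| * (T * `|e
    T| / m) by ring.
  have w0 : 0 < T * `|e T| / m by rewrite divr_gt0 // mulr_gt0.
  apply: le_trans (_ : M * B / (`|e T| * T) * (T * `|e T| / m) <= _);
    first by rewrite ler_pM2r.
  by rewrite le_eqVlt; apply/orP; left; apply/eqP; field; rewrite !gt_eqF.
have lcB := lc_terms_le tq.
have CB0 : 0 <= C3 * B by rewrite mulr_ge0.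
have M0 : (size es)%:R * (C3 * B) <= (size es).+1%:R * (C3 * B).
  by apply: ler_wpM2r => //; rewrite ler_nat.
have M1 : C3 * B <= (size es).+1%:R * (C3 * B) by rewrite ler_peMl // ler1n.
split; last first.
  by apply: terms_leW tq; rewrite mulrDl mul1r -mulrA (le_trans M1) // lerDr.
(* The first term, removed by the derivation, is recovered by subtracting the others from the value
   at [T]. *)
have -> : c 0%N * e T = lc (e :: es) c T - lc es c' T by rewrite /= addrK.
apply: le_trans (ler_normB _ _) _.
by rewrite mulrDl mul1r -mulrA lerD ?fB ?(ltW T2) // (le_trans lcB).
Qed.

End Scales.

(** * Echelon families and estimates on half-lines *)

Section Echelon.
Unset Implicit Arguments.
Context {R : realType} {D : forall n : nat, set (set 'rV[R]_n)}.
Set Implicit Arguments.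
Context (D_omin : o_minimal_structure D) (D_pb : polynomially_bounded D).
Implicit Types (f e x y b : R -> R) (es : seq (R -> R)) (c : nat -> R).

(** The two cases are an infinite and a finite limit [l] of [b / e], provided by
    [definable_limit]. *)
Lemma oo_or_proportional b e : definable1 D b -> definable1 D e ->
  (\forall t \near +oo, e t != 0) ->
  ((\forall t \near +oo, b t != 0) /\ oo e b) \/
  exists l : R, oo (fun t => b t + (- l) * e t) e.
Proof.
move=> db de e0; have dq : definable1 D (fun t => b t / e t) by definability.
have inf : (forall M, \forall t \near +oo, M < `|b t / e t|) ->
    (\forall t \near +oo, b t != 0) /\ oo e b.
  move=> h; split.
    by apply: filterS (h 0) => t; apply: contraTneq => ->;
      rewrite mul0r normr0 ltxx.
  move=> eps eps0; apply: filterS2 e0 (h eps^-1) => t et0.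
  rewrite normrM normfV => /ltW; rewrite ler_pdivlMr ?normr_gt0 //.
  by rewrite -ler_pdivlMl ?invr_gt0 // invrK.
case: (definable_limit D_omin dq) => [h|h|[l hl]].
- by left; apply: inf => M; apply: filterS (h M) => t /lt_le_trans; apply;
  exact: ler_norm.
- left; apply: inf => M; apply: filterS (h (- M)) => t h'.
  by apply: lt_le_trans (_ : - (b t / e t) <= _);
    [rewrite ltrNr|rewrite -normrN ler_norm].
right; exists l => eps eps0; apply: filterS2 e0 (hl _ eps0) => t et0 h.
have -> : b t + - l * e t = (b t / e t - l) * e t by rewrite mulrBl divfK //
  mulNr.
by rewrite normrM ler_wpM2r // ltW.
Qed.

(** Gaussian elimination by orders of growth: [b] goes in front if it dominates the head [e];
    otherwise a multiple of [e] is subtracted, and the remainder, negligible against [e], is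
    inserted further on. The last clause is what allows [e] to be put back in front of the new
    tail. *)
Lemma chain_insert es b : chain (D := D) es -> definable1 D b -> exists es',
  [/\ chain (D := D) es',
    forall c (k : R), exists c', \forall t \near +oo,
      lc es c t + k * b t = lc es' c' t &
    forall z, every (fun x => oo x z) es -> oo b z -> every (fun x =>
      oo x z) es'].
Proof.
elim: es b => [|e es IH] b.
  move=> _ db; have [b0|b0] : (\forall t \near +oo,
    b t != 0) \/ (\forall t \near +oo, b t = 0).
  - case: (near_sign D_omin db) => h; [left|left|by right].
    + by apply: filterS h => t /gt_eqF ->.
    + by apply: filterS h => t /lt_eqF ->.
  - exists [:: b]; split=> // c k; exists (fun=> k).
    by apply: filterS b0 => t _ /=; rewrite addr0 add0r.
  - by exists [::]; split=> // c k; exists c; apply: filterS b0 => t -> /=;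
    rewrite mulr0 addr0.
move=> [de e0 ese ces] db; have [[b0 eb]|[l be]] := oo_or_proportional db de e0.
  exists (b :: e :: es); split.
  - split=> //; split=> //; apply: every_imp ese => x xe; exact: oo_trans xe eb.
  - move=> c k; exists (fun i => if i is j.+1 then c j else k).
    by apply: filterS e0 => t _ /=; rewrite addrC.
  - by move=> z [ez esz] bz; split.
have db1 : definable1 D (fun t => b t + (- l) * e t) by definability.
have [es' [ch' sp oz]] := IH _ ces db1; exists (e :: es'); split.
- by split=> //; exact: oz.
- move=> c k; have [c' hc'] := sp (fun i => c i.+1) k.
  exists (fun i => if i is j.+1 then c' j else c 0%N + k * l).
  by apply: filterS hc' => t /= <-; ring.
- by move=> z [ez esz] bz; split=> //; apply: oz => //; apply: oo_comb.
Qed.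

Lemma lc0 es (t : R) : lc es (fun=> 0) t = 0.
Proof. by elim: es => //= e es ->; rewrite mul0r addr0. Qed.

Lemma echelon bs : every (definable1 D) bs -> exists es, chain (D := D) es /\
  every (fun b => exists c, \forall t \near +oo, b t = lc es c t) bs.
Proof.
elim: bs => [_|b bs IH [db /IH[es [ch sp]]]]; first by exists [::].
have [es' [ch' sp' _]] := chain_insert ch db; exists es'; split=> //; split.
  have [c hc] := sp' (fun=> 0) 1; exists c.
  by apply: filterS hc => t <-; rewrite lc0 add0r mul1r.
apply: every_imp sp => x [c hc]; have [c' hc'] := sp' c 0; exists c'.
by apply: filterS2 hc hc' => t -> <-; rewrite mul0r addr0.
Qed.

Lemma everyP (T : Type) (P : T -> Prop) (x0 : T) s :
  every P s <-> forall j, (j < size s)%N -> P (nth x0 s j).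
Proof.
elim: s => [|x s IH] //=; split; first by move=> [Px /IH h] [|j] //; exact: h.
by move=> h; split; [exact: (h 0%N)|apply/IH => j; exact: (h j.+1)].
Qed.

Lemma terms_leP es c (T M : R) : terms_le es c T M <->
  forall j, (j < size es)%N -> `|c j * nth (fun=> 0) es j T| <= M.
Proof.
elim: es c => [|x es IH] c //=; split; first by move=> [h1 /IH h2] [|j] //;
  exact: h2.
by move=> h; split; [exact: (h 0%N)|apply/IH => j; exact: (h j.+1)].
Qed.

Definition infinitesimal f := oo f (fun=> 1).

(** If [e] tends to an infinity, [|e|] is eventually nondecreasing because its index is positive;
    otherwise [e] has a limit [l <> 0]. These are the functions whose earlier values are controlled
    by later ones. *)
Lemma quasi_increasing e : definable1 D e -> (\forall t \near +oo, e t != 0) ->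
  ~ infinitesimal e -> exists a A d : R, [/\ 0 <= A, 0 < d &
    forall s t, a < s -> s <= t -> d <= `|e s| /\ `|e s| <= A * `|e t|].
Proof.
move=> de e0 ninf.
have pinf f : definable1 D f -> (forall M, \forall t \near +oo, M < f t) ->
    exists a A d : R, [/\ 0 <= A, 0 < d &
    forall s t, a < s -> s <= t -> d <= `|f s| /\ `|f s| <= A * `|f t|].
  move=> df finf; have [m [m0 hm]] := index_lower_pos D_omin D_pb df finf.
  have /near_pinftyP[a aP] := near_and (near_and (finf 1) hm)
    (near_and (near_gt 0) (der_near D_omin df)).
  exists a, 1, 1; split=> // s t sa st.
  have [[fs _] _] := aP s sa; have [[ft _] _] := aP t (lt_le_trans sa st).
  rewrite !gtr0_norm ?(lt_trans ltr01) // ltW // mul1r; split=> //.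
  apply: (derive_nondecreasing (df := der f) st) => r sr rt.
    by have [_ []] := aP r (lt_le_trans sa sr).
  have [[fr mr] [r0 _]] := aP r (lt_le_trans sa sr).
  rewrite -(pmulr_rge0 _ r0); apply: le_trans mr; apply: mulr_ge0;
    rewrite ltW //.
  exact: lt_trans ltr01 fr.
case: (definable_limit D_omin de) => [h|h|[l hl]]; first exact: pinf.
  have dN : definable1 D (fun t => - e t) by definability.
  have [|a [A [d [A0 d0 h']]]] := pinf _ dN.
    by move=> M; apply: filterS (h (- M)) => t; rewrite ltrNr.
  by exists a, A, d; split=> // s t sa st; have := h' s t sa st;
    rewrite !normrN.
have l0 : 0 < `|l|.
  rewrite normr_gt0; apply: contra_not_neq ninf => l0 eps eps0.
  by apply: filterS (hl _ eps0) => t /ltW; rewrite l0 subr0 normr1 mulr1.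
have l2 : 0 < `|l| / 2 by rewrite divr_gt0.
have /near_pinftyP[a aP] := hl _ l2.
(* Both absolute values lie between [|l| / 2] and [3 |l| / 2], so any factor from 3 on would do. *)
exists a, 4, (`|l| / 2); split=> // s t sa st.
have := aP s sa; have := aP t (lt_le_trans sa st).
have := ler_normB (e s) (e s - l); have := ler_normD (e s - l) l.
have := ler_normB (e t) (e t - l).
rewrite !subKr subrK; move: `|e s| `|e t| `|l| `|e s - l| `|e t - l| => *;
  split; lra.
Qed.

Lemma nth_le_sum n (F : nat -> R) (P : pred nat) j : (forall i,
  0 <= F i) -> (j < n)%N -> P j ->
  F j <= \sum_(i < n | P i) F i.
Proof.
move=> F0 jn Pj; rewrite (bigD1 (Ordinal jn)) //= lerDl.
by apply: sumr_ge0.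
Qed.

(* The lower bound on the coefficients along the functions not tending to [0]
   is what makes the estimate propagate from [u, v] to the left. *)
Lemma global_growth es (K : R) : chain (D := D) es -> 0 <= K ->
  exists (a C : R) N, [/\ 0 < a, 0 <= C & forall c (u v s B : R),
    (forall j, (j < size es)%N -> `|c j| <=
       K * \sum_(i < size es | ~~ `[< infinitesimal (nth (fun=>
         0) es i) >]) `|c i|) ->
    a < u -> u < v -> a < s ->
    (forall t, u <= t -> t <= v -> `|lc es c t| <= B) ->
    `|lc es c s| <= C * (Num.max v s / (v - u)) ^+ N * B].
Proof.
move=> ch K0; have des := chain_definable ch.
set n := size es; set e := nth (fun=> 0) es.
have he j : (j < n)%N -> definable1 D (e j) /\ \forall t \near +oo, e j t != 0.
  by move=> jn; have /everyP := every_chain ch; apply.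
(* Constants common to all [e j]. The power of [max t s / t] is 1 for [s <= t], where
   [quasi_increasing] applies, and accounts for polynomial growth when [s] is beyond [t]. *)
have [a1 [A [d [m [a10 A1 d0 hA]]]]] : exists (a A d : R) m, [/\ 0 < a, 1 <= A,
  0 < d &
    forall j s t, (j < n)%N -> a < s -> a < t ->
    (infinitesimal (e j) -> `|e j s| <= 1) /\
    (~ infinitesimal (e j) -> d <= `|e j t| /\
       `|e j s| <= A * (Num.max t s / t) ^+ m * `|e j t|)].
  elim: {1 3}n (leqnn n) => [|k IH] kn.
    by exists 1, 1, 1, 0%N; split.
  have [a [A [d [m [a0 A1 d0 h]]]]] := IH (ltnW kn).
  have [dk k0] := he k kn.
  have [ik|nik] := pselect (infinitesimal (e k)).
    have /near_pinftyP[a' ha'] := ik 1 ltr01.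
    exists (Num.max a a'), A, d, m; split=> //; first by rewrite lt_max a0.
    move=> j s t; rewrite ltnS leq_eqVlt !gt_max =>
      /predU1P[->|jk] /andP[sa sa'] /andP[ta ta'].
      by split=> // _; have := ha' s sa'; rewrite mul1r normr1.
    exact: h.
  have [a' [A' [d' [A'0 d'0 h']]]] := quasi_increasing dk k0 nik.
  have [m' [a'' [a''0 h'']]] := polynomial_growth D_omin D_pb dk k0.
  exists (Num.max a (Num.max a' a'')), (Num.max A A'), (Num.min d d'),
    (m + m')%N.
  split; [by rewrite lt_max a0|by rewrite le_max A1|by rewrite lt_min d0|].
  move=> j s t; rewrite ltnS !gt_max => jk /and3P[s1 s2 s3] /and3P[t1 t2 t3].
  have t0 : 0 < t by exact: lt_trans t1.
  have r1 : 1 <= Num.max t s / t by rewrite ler_pdivlMr // mul1r le_max lexx.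
  move: jk; rewrite leq_eqVlt => /predU1P[->|jk].
    split=> // _; split.
      by have [h1 _] := h' t t t2 (lexx _); rewrite ge_min h1 orbT.
    have [st|/ltW ts] := leP s t.
      have [_ h2] := h' s t s2 st; apply: le_trans h2 _; apply: ler_wpM2r => //.
      by rewrite divff ?gt_eqF // expr1n mulr1 le_max lexx orbT.
    have [h2 _] := h'' t s t3 ts; rewrite (max_r ts) in r1.
    have h3 : `|e k s| <= (s / t) ^+ m' * `|e k t|.
      by rewrite expr_div_n mulrAC ler_pdivlMr ?exprn_gt0 // [leRHS]mulrC.
    apply: le_trans h3 _; apply: ler_wpM2r => //.
    rewrite exprD mulrA ler_peMl ?exprn_ge0 ?(le_trans ler01) //.
    by rewrite mulr_ege1 ?exprn_ege1 // le_max A1.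
  have [h1 h2] := h j s t jk s1 t1; split=> // /h2[h3 h4]; split.
    by rewrite ge_min h3.
  apply: le_trans h4 _; apply: ler_wpM2r => //; apply: ler_pM.
  - by apply: le_trans A1.
  - by rewrite exprn_ge0 // (le_trans ler01).
  - by rewrite le_max lexx.
  - by apply: ler_weXn2l => //; exact: leq_addr.
have [a2 [C2 [a20 C20 hQ]]] := chain_terms_le D_omin D_pb ch.
have [a3 [C3 [N [a30 C30 hL]]]] := local_remez D_omin D_pb des.
have A0 : 0 <= A by exact: le_trans A1.
(* [A] serves the [e j] not tending to 0. For the others [|e j s| <= 1], and the coefficient is at
   most [K] times the sum of at most [n] selected ones, each at most [1 / d] times its term at the
   reference point [T]. *)
pose C4 := A + K * (n%:R / d).
have C40 : 0 <= C4.
  by apply: addr_ge0; rewrite ?A0 //; apply: mulr_ge0 => //;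
    apply: divr_ge0 => //; exact: ltW.
exists (Num.max a1 (Num.max a2 a3)), (n%:R * C4 * C2 * C3 * 2 ^+ (m + N)),
  (m + N)%N; split.
- by rewrite lt_max a10.
- by rewrite !mulr_ge0 ?exprn_ge0.
move=> c u v s B cK; rewrite !gt_max => /and3P[u1 u2 u3] uv /and3P[s1 s2 s3] fB.
(* Since [u > 0], the midpoint satisfies [v <= 2 * T], and [[T, v]] keeps half of the length. The
   local inequality extends the bound from [[T, v]] to [[T, 2T]], which bounds each term at [T];
   each is then carried to [s]. *)
pose T := (u + v) / 2; have [uT Tv] := midf_lt uv; rewrite -/T in uT Tv.
have u0 : 0 < u by exact: lt_trans u1.
have T0 : 0 < T by exact: lt_trans uT.
have vT : v <= 2 * T by rewrite /T; clear -u0; lra.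
have vTE : v - T = (v - u) / 2 by rewrite /T; clear; lra.
have vT0 : 0 < v - T by rewrite subr_gt0.
have Tq0 : 0 <= T / (v - T) by rewrite divr_ge0 // ltW.
have T_gt a : a < u -> a < T by move=> /lt_trans; exact.
have fT : forall t, T <= t -> t <= 2 * T ->
    `|lc es c t| <= C3 * (T / (v - T)) ^+ N * B.
  have -> : T / (v - T) = (2 * T - T) / (v - T) by congr (_ / _); ring.
  apply: hL => //; first exact: T_gt.
  by move=> t Tt tv; apply: fB => //; exact: le_trans (ltW uT) Tt.
have tT := hQ c T _ (T_gt _ u2) fT; set M := C2 * _ in tT.
have M0 : 0 <= M.
  have B0 : 0 <= B by apply: le_trans (normr_ge0 _) (fB u _ _) => //;
    exact: ltW.
  by do 3![apply: mulr_ge0 => //]; exact: exprn_ge0.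
pose r := Num.max T s / T.
have r1 : 1 <= r by rewrite ler_pdivlMr // mul1r le_max lexx.
have /terms_leP tT' := tT.
have sum_le : \sum_(i < n | ~~ `[< infinitesimal (e i) >]) `|c i| <= n%:R / d *
  M.
  apply: le_trans (_ : \sum_(i < n) M / d <= _); last first.
    by rewrite sumr_const card_ord -mulr_natl; clear; lra.
  rewrite big_mkcond; apply: ler_sum => i _; case: ifPn => [/asboolPn ni|_];
    last first.
    by rewrite divr_ge0 // ltW.
  have [_ /(_ ni)[dle _]] := hA i s T (ltn_ord i) s1 (T_gt _ u1).
  rewrite ler_pdivlMr //; apply: le_trans (tT' i (ltn_ord i)).
  by rewrite normrM ler_wpM2l.
have ts : terms_le es c s (C4 * r ^+ m * M).
  apply/terms_leP => j jn; rewrite -/(e j) normrM.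
  have rm1 : 1 <= r ^+ m by rewrite exprn_ege1.
  have [inf_j ninf_j] := hA j s T jn s1 (T_gt _ u1).
  have [ij|nij] := pselect (infinitesimal (e j)).
    apply: le_trans (_ : `|c j| * 1 <= _); first by rewrite ler_wpM2l // inf_j.
    rewrite mulr1; apply: le_trans (cK j jn) _.
    apply: le_trans (ler_wpM2l K0 sum_le) _.
    rewrite mulrA; apply: ler_wpM2r => //.
    apply: le_trans (_ : C4 * 1 <= _); last by rewrite ler_wpM2l.
    by rewrite mulr1 /C4 lerDr.
  have [_ h] := ninf_j nij.
  apply: le_trans (ler_wpM2l (normr_ge0 _) h) _.
  rewrite mulrCA -normrM -/r; apply: ler_pM => //.
  - by apply: mulr_ge0 => //; exact: le_trans rm1.
  - apply: ler_wpM2r; first exact: le_trans rm1.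
    by rewrite /C4 lerDl; apply: mulr_ge0 => //; apply: divr_ge0 => //;
      exact: ltW.
  - exact: tT'.
apply: le_trans (lc_terms_le ts) _; rewrite -/n /M.
pose q := Num.max v s / (v - u).
have vu0 : 0 < v - u by rewrite subr_gt0.
have q0 : 0 <= q by rewrite divr_ge0 ?(ltW vu0) // le_max (ltW (lt_trans u0
  uv)).
have B0 : 0 <= B by apply: le_trans (normr_ge0 _) (fB u _ _) => //; exact: ltW.
have vm : v <= Num.max v s by rewrite le_max lexx.
have Tm : T <= Num.max v s by exact: le_trans (ltW Tv) vm.
have uT2 : v - u <= 2 * T by rewrite (le_trans _ vT) // gerBl ltW.
have mm : Num.max T s <= Num.max v s by rewrite ge_max Tm le_max lexx orbT.
have rq : r <= 2 * q.
  rewrite ler_pdivrMr // (_ : 2 * q * T = Num.max v s * (2 * T) / (v - u));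
    last by rewrite /q; ring.
  rewrite ler_pdivlMr //; apply: ler_pM => //; last exact: ltW.
  by rewrite le_max (ltW T0).
have Tq : T / (v - T) <= 2 * q.
  rewrite vTE invf_div mulrA ler_pdivrMr //.
  have -> : 2 * q * (v - u) = 2 * Num.max v s by rewrite -mulrA /q mulfVK
    ?gt_eqF.
  by rewrite mulrC ler_pM2l.
have -> : n%:R * C4 * C2 * C3 * 2 ^+ (m + N) * q ^+ (m + N) * B =
    n%:R * (C4 * ((2 * q) ^+ m) * (C2 * (C3 * ((2 * q) ^+ N) * B))).
  rewrite !exprD !(exprMn _ 2 q); move: n%:R (2 ^+ m) (2 ^+ N) (q ^+ m)
    (q ^+ N) => k w1 w2 w3 w4.
  by ring.
have r0 : 0 <= r by exact: le_trans r1.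
have q20 : 0 <= 2 * q by exact: mulr_ge0.
have rm : r ^+ m <= (2 * q) ^+ m by rewrite lerXn2r.
have TN : (T / (v - T)) ^+ N <= (2 * q) ^+ N by rewrite lerXn2r.
apply: ler_wpM2l => //; apply: ler_pM.
- by apply: mulr_ge0 => //; exact: exprn_ge0.
- exact: M0.
- exact: ler_wpM2l.
by apply: ler_wpM2l => //; apply: ler_wpM2r => //; apply: ler_wpM2l.
Qed.

(** If [y <= 2 x], the local inequality applies. Otherwise [y <= 2 (y - x)], so the ratio
    [max v t / (v - u)] in [global_growth] is at most twice [(y - x) / (v - u)]. *)
Lemma global_remez es (K : R) : chain (D := D) es -> 0 <= K ->
  exists (a C : R) N, [/\ 0 < a, 0 <= C & forall c (x y u v B : R),
    (forall j, (j < size es)%N -> `|c j| <=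
       K * \sum_(i < size es | ~~ `[< infinitesimal (nth (fun=>
         0) es i) >]) `|c i|) ->
    a < x -> x <= u -> u < v -> v <= y ->
    (forall t, u <= t -> t <= v -> `|lc es c t| <= B) ->
    forall t, x <= t -> t <= y -> `|lc es c t| <= C * ((y - x) / (v - u)) ^+ N
      * B].
Proof.
move=> ch K0; have [a1 [C1 [N1 [a10 C10 hG]]]] := global_growth ch K0.
have [a2 [C2 [N2 [a20 C20 hL]]]] := local_remez D_omin D_pb (chain_definable
  ch).
exists (Num.max a1 a2), (C1 * 2 ^+ N1 + C2), (N1 + N2)%N; split.
- by rewrite lt_max a10.
- by apply: addr_ge0 => //; apply: mulr_ge0 => //; exact: exprn_ge0.
move=> c x y u v B cK; rewrite gt_max => /andP[x1 x2] xu uv vy fB t xt ty.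
have B0 : 0 <= B by apply: le_trans (normr_ge0 _) (fB u _ _) => //; exact: ltW.
have vu0 : 0 < v - u by rewrite subr_gt0.
pose q := (y - x) / (v - u).
have q1 : 1 <= q by rewrite ler_pdivlMr // mul1r lerB.
have q0 : 0 <= q by exact: le_trans q1.
have X10 : 0 <= C1 * 2 ^+ N1 by apply: mulr_ge0 => //; exact: exprn_ge0.
have [yx|xy] := leP y (2 * x).
  apply: le_trans (hL c x x y u v B x2 (lexx _) xu uv vy yx fB t xt ty) _.
  rewrite -/q; apply: ler_wpM2r => //; apply: ler_pM => //.
  - exact: exprn_ge0.
  - by rewrite lerDr.
  - by apply: ler_weXn2l => //; exact: leq_addl.
have x0 : 0 < x by exact: lt_trans x1.
apply: le_trans (hG c u v t B cK _ uv _ fB) _;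
  [exact: lt_le_trans xu|exact: lt_le_trans xt|].
rewrite -/q; apply: ler_wpM2r => //.
have mq : Num.max v t / (v - u) <= 2 * q.
  rewrite /q mulrA ler_pM2r ?invr_gt0 //.
  have my : Num.max v t <= y by rewrite ge_max vy.
  apply: le_trans my _; lra.
have m0 : 0 <= Num.max v t / (v - u).
  by apply: divr_ge0; [rewrite le_max (le_trans (ltW x0) xt) orbT|exact: ltW].
have q20 : 0 <= 2 * q by exact: mulr_ge0.
apply: le_trans (_ : C1 * (2 * q) ^+ N1 <= _).
  by apply: ler_wpM2l => //; rewrite lerXn2r.
rewrite exprMn mulrA; apply: ler_pM => //.
- exact: exprn_ge0.
- by rewrite lerDl.
- by apply: ler_weXn2l => //; exact: leq_addr.
Qed.

End Echelon.

(** * Sublevel sets and closed cones *)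

Section Goodness.
Context {R : realType}.
Implicit Types (f : R -> R) (X I : set R).
Local Notation mu := (@lebesgue_measure R).

Lemma interval_measure_le X (l : R) : 0 <= l -> is_interval X ->
  (forall u v, X u -> X v -> u < v -> v - u <= l) -> (mu X <= l%:E)%E.
Proof.
move=> l0 iX Xl; have [->|/set0P[x Xx]] := eqVneq X set0.
  by rewrite measure0 lee_fin.
have Xle u v : X u -> X v -> v - u <= l.
  by move=> Xu Xv; have [/Xl|vu] := ltP u v; [apply|apply: le_trans l0;
    rewrite subr_le0].
have ubX u : X u -> ubound X (u + l) by move=> Xu v Xv; rewrite -lerBlDl Xle.
have hS : has_sup X by split; [exists x|exists (x + l); exact: ubX].
have hI : has_inf X.
  by split; [exists x|exists (x - l) => v Xv; rewrite lerBlDr -lerBlDl Xle].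
have sl : sup X - inf X <= l.
  rewrite lerBlDl -lerBlDr; apply: lb_le_inf => [|u Xu]; first by exists x.
  by rewrite lerBlDr; apply: ge_sup; [exists x|exact: ubX].
have XS : X `<=` `[inf X, sup X]%classic.
  move=> v Xv /=; rewrite in_itv /=; apply/andP; split.
    by apply: ge_inf => //; case: hI.
  by apply: ub_le_sup => //; case: hS.
apply: (@le_trans _ _ (mu `[inf X, sup X]%classic)).
  by apply: le_measure => //; rewrite inE; [exact:
    measurable_realfun.is_interval_measurable|exact: measurable_itv].
rewrite lebesgue_measure_itv /=; case: ifP => _; last by rewrite lee_fin.
by rewrite -EFinB lee_fin.
Qed.

Lemma interval_measure_ge X u v : is_interval X -> X u -> X v -> ((v - u)%:E <=
  mu X)%E.
Proof.
move=> iX Xu Xv; have [uv|vu] := ltP u v; last first.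
  by apply: le_trans (measure_ge0 _ _); rewrite lee_fin subr_le0.
have -> : (v - u)%:E = mu `[u, v]%classic by rewrite lebesgue_measure_itv /=
  lte_fin uv -EFinB.
apply: le_measure; rewrite ?inE; [exact: measurable_itv|exact:
  measurable_realfun.is_interval_measurable|].
by move=> t /=; rewrite in_itv /=; exact: iX.
Qed.

Lemma monotone_sublevel f (eps x y : R) I : is_interval I -> monotone_on f x y
  ->
  is_interval ([set t | I t /\ (`|f t| <= eps)%R] `&` `[x, y]).
Proof.
move=> iI fm p q /= [[Ip fp] pxy] [[Iq fq] qxy] t /andP[pt tq].
move: pxy qxy; rewrite !in_itv /= => /andP[xp py] /andP[xq qy].
split; last by rewrite (le_trans xp pt) (le_trans tq qy).
split; first by apply: (iI p q) => //; rewrite pt.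
move: fp fq; rewrite !ler_norml => /andP[p1 p2] /andP[q1 q2].
have yt := le_trans tq qy; have xt := le_trans xp pt.
case: fm => fm.
  by rewrite (le_trans p1 (fm _ _ xp pt yt)) (le_trans (fm _ _ xt tq qy) q2).
by rewrite (le_trans q1 (fm _ _ xt tq qy)) (le_trans (fm _ _ xp pt yt) p2).
Qed.

Lemma pw_measure (P : R -> R -> Prop) (A : set R)
  (l : R) n x y : x <= y -> pw n P x y ->
  (forall p q, x <= p -> q <= y -> P p q ->
     measurable (A `&` `[p, q]) /\ (mu (A `&` `[p, q]) <= l%:E)%E) ->
  measurable (A `&` `[x, y]) /\ (mu (A `&` `[x, y]) <= (2 ^+ n * l)%:E)%E.
Proof.
elim: n x y => [|n IH] x y xy; first by move=> /= Pxy; rewrite expr0 mul1r;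
  exact.
move=> /= [m [xm my P1 P2]] PA.
have [|m1 l1] := IH x m xm P1.
  by move=> p q xp qm; apply: PA => //; exact: le_trans qm my.
have [|m2 l2] := IH m y my P2.
  by move=> p q mp qy; apply: PA => //; exact: le_trans xm mp.
have -> : A `&` `[x, y] = (A `&` `[x, m]) `|` (A `&` `[m, y]).
  apply/seteqP; split => t /=; rewrite !in_itv /=.
    move=> [At /andP[xt ty]]; have [tm|/ltW mt] := leP t m; [left|right];
      split=> //.
      by rewrite xt.
    by rewrite ty andbT.
  case=> -[At /andP[h1 h2]]; split=> //; apply/andP; split=> //.
    exact: le_trans h2 my.
  exact: le_trans xm h1.
split; first exact: measurableU.
apply: le_trans (measureU2 _ _ _) _ => //; apply: le_trans (leeD l1 l2) _.
by rewrite -EFinD lee_fin exprS -mulrA mulr_natl mulr2n.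
Qed.

Lemma good_of_remez (a C : R) n N : 0 < a -> 0 <= C -> exists C' alpha : R,
  [/\ 0 < C', 0 < alpha & forall h : halfline_fun R, let f := at_real h in
   (forall x y, a < x -> x <= y -> pw n (monotone_on f) x y) ->
   (forall x y u v B : R, a < x -> x <= u -> u < v -> v <= y ->
      (forall t, u <= t -> t <= v -> `|f t| <= B) ->
      forall t, x <= t -> t <= y -> `|f t| <= C * ((y - x) / (v - u)) ^+ N * B)
        ->
   forall T0, a < T0 -> good C' alpha T0 h].
Proof.
(* [C1] is positive even if [C = 0], and [al] even if [N = 0]. Raising the exponent to [N.+1] is
   harmless, the ratio of lengths being at least 1. *)
move=> a0 C0; pose C1 := C + 1; pose al : R := N.+1%:R^-1.
have C10 : 0 < C1 by rewrite ltr_wpDl.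
have al0 : 0 < al by rewrite invr_gt0.
exists (2 ^+ n * C1 `^ al), al; split=> //.
  by rewrite mulr_gt0 ?exprn_gt0 ?powR_gt0.
move=> h f fpw frem T0 aT0 eps I eps0 iI bI IT.
have [->|/set0P[x0 Ix0]] := eqVneq I set0.
  rewrite (_ : [set t | _] = set0); last by apply/seteqP; split=> t // [].
  by rewrite measure0 mule0.
have hS : has_sup I.
  split; first by exists x0.
  have [M [_ hM]] := bI; exists (M + 1) => t It.
  by apply: le_trans (ler_norm t) _; apply: hM => //; rewrite ltrDl.
have hI : has_inf I.
  by split; [exists x0|exists T0 => t /IT /=; rewrite in_itv /= andbT].
pose x := inf I; pose y := sup I.
have xI t : I t -> x <= t by move=> It; apply: ge_inf => //; case: hI.
have yI t : I t -> t <= y by move=> It; apply: ub_le_sup => //; case: hS.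
have Tx : T0 <= x.
  by apply: lb_le_inf => [|t /IT /=]; [exists x0|rewrite in_itv /= andbT].
have xy : x <= y by exact: le_trans (xI _ Ix0) (yI _ Ix0).
set E := [set t | I t /\ (`|f t| <= eps)%R].
have EI : E = E `&` `[x, y].
  apply/seteqP; split=> t; last by case.
  by move=> [It ft]; split=> //=; rewrite in_itv /= xI // yI.
have bound (l : R) : 0 <= l -> (forall u v, u < v -> (forall t,
  u <= t -> t <= v -> E t) -> v - u <= l) ->
    (mu E <= (2 ^+ n * l)%:E)%E.
  move=> l0 El; rewrite EI.
  apply: (proj2 (pw_measure xy (fpw x y (lt_le_trans aT0 Tx) xy) _)) =>
    p q xp qy fm.
  have iE := monotone_sublevel (eps := eps) iI fm.
  split; first exact: measurable_realfun.is_interval_measurable.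
  apply: interval_measure_le => // u v Eu Ev uv; apply: El => // t ut tv.
  by case: (iE u v Eu Ev t); rewrite ?ut.
have yx0 : 0 <= y - x by rewrite subr_ge0.
have muI : ((y - x)%:E <= mu I)%E.
  apply/lee_addgt0Pr => e e0; have e2 : 0 < e / 2 by rewrite divr_gt0.
  have [v Iv yv] := sup_adherent e2 hS; have [u Iu ux] := inf_adherent e2 hI.
  apply: le_trans (_ : ((v - u) + e)%:E <= _)%E.
    by rewrite lee_fin; rewrite -/y -/x in yv ux; lra.
  by rewrite EFinD leeD2r //; exact: interval_measure_ge.
(* The Remez inequality with [B = eps] on an interval of the sublevel set: a long one forces [f] to
   be small on all of [I]. *)
have Ele u v : u < v -> (forall t, u <= t -> t <= v -> E t) -> forall t, I t ->
    `|f t| <= C1 * ((y - x) / (v - u)) ^+ N.+1 * eps.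
  move=> uv uvE t It.
  have Iu : I u by have [] := uvE u (lexx _) (ltW uv).
  have Iv : I v by have [] := uvE v (ltW uv) (lexx _).
  pose p := Num.min u t; pose q := Num.max v t.
  have xp : x <= p by rewrite le_min !xI.
  have qy : q <= y by rewrite ge_max !yI.
  apply: le_trans (_ : C * ((q - p) / (v - u)) ^+ N * eps <= _).
    apply: frem => //.
    - exact: lt_le_trans (lt_le_trans aT0 Tx) xp.
    - by rewrite ge_min lexx.
    - by rewrite le_max lexx.
    - by move=> s us sv; have [] := uvE s us sv.
    - by rewrite ge_min lexx orbT.
    - by rewrite le_max lexx orbT.
  apply: ler_wpM2r; first exact: ltW.
  have vu0 : 0 < v - u by rewrite subr_gt0.
  have pu : p <= u by rewrite ge_min lexx.
  have vq : v <= q by rewrite le_max lexx.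
  have q1 : 1 <= (y - x) / (v - u).
    by rewrite ler_pdivlMr // mul1r lerB // ?yI ?xI.
  have pq0 : 0 <= (q - p) / (v - u) by rewrite divr_ge0 ?(ltW vu0) // subr_ge0
    (le_trans pu) // (le_trans (ltW uv)).
  apply: ler_pM => //; first exact: exprn_ge0.
    by rewrite lerDl.
  apply: le_trans (_ : ((y - x) / (v - u)) ^+ N <= _).
    rewrite lerXn2r ?nnegrE ?(le_trans ler01 q1) //.
    by rewrite ler_pM2r ?invr_gt0 // lerB.
  by apply: ler_weXn2l.
have S0 : (0 <= sup_norm h I)%E.
  apply: le_trans (_ : (`|f x0|%:E <= _)%E); first by rewrite lee_fin.
  by apply: ereal_sup_ubound; exists x0.
have Sub t : I t -> (`|f t|%:E <= sup_norm h I)%E.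
  by move=> It; apply: ereal_sup_ubound; exists t.
have Sle (M : R) : (forall t, I t -> `|f t| <= M) -> (sup_norm h I <= M%:E)%E.
  by move=> hM; apply: ub_ereal_sup => _ [t It <-]; rewrite lee_fin; exact: hM.
have key : (mu E <= (2 ^+ n * C1 `^ al)%:E * poweR (eps%:E / sup_norm h I) al *
  (y - x)%:E)%E.
  move: S0 Sub Sle; case: (sup_norm h I) => [S||] //.
  - rewrite lee_fin le_eqVlt => /predU1P[<-|S0] Sub Sle.
      (* Supremum 0: the right-hand side is infinite, unless [y = x], where both sides vanish. *)
      have [xy'|xy'] := eqVneq (y - x) 0.
        rewrite xy' mule0; have := bound 0 (lexx 0); rewrite mulr0;
          apply => u v uv uvE.
        rewrite -xy'; apply: lerB; first by apply: yI;
          have [] := uvE v (ltW uv) (lexx _).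
        by apply: xI; have [] := uvE u (lexx _) (ltW uv).
      rewrite inve0 gt0_muley ?lte_fin // poweRyr ?gt_eqF // gt0_muley ?lte_fin.
        rewrite gt0_mulye ?leey // lte_fin lt_neqAle eq_sym xy' //.
      by rewrite mulr_gt0 ?exprn_gt0 ?powR_gt0.
    rewrite inver (gt_eqF S0) -(EFinM eps S^-1) poweR_EFin -!EFinM.
    have E2 : 2 ^+ n * C1 `^ al * (eps / S) `^ al * (y - x) =
      2 ^+ n * ((C1 * (eps / S)) `^ al * (y - x)).
      have eS : 0 <= eps / S by rewrite divr_ge0 ?ltW.
      by rewrite (@powRM _ C1 (eps / S)) ?(ltW C10) //; ring.
    rewrite E2; apply: bound; first by rewrite mulr_ge0 ?powR_ge0.
    move=> u v uv uvE; have vu0 : 0 < v - u by rewrite subr_gt0.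
    have := Sle _ (Ele u v uv uvE); rewrite lee_fin => Sb.
    have eS0 : 0 < C1 * (eps / S) by rewrite mulr_gt0 // divr_gt0.
    have yx1 : 0 < y - x.
      apply: lt_le_trans vu0 _; apply: lerB.
        by apply: yI; have [] := uvE v (ltW uv) (lexx _).
      by apply: xI; have [] := uvE u (lexx _) (ltW uv).
    have w0 : 0 <= (v - u) / (y - x) by rewrite divr_ge0 // ltW.
    have q1 : ((v - u) / (y - x)) ^+ N.+1 <= C1 * (eps / S).
      rewrite mulrA ler_pdivlMr //; apply: le_trans (ler_wpM2l (exprn_ge0 _ w0)
        Sb) _.
      rewrite mulrA mulrCA -exprMn (_ : (v - u) / (y - x) * ((y - x) / (v - u))
        = 1).
        by rewrite expr1n mulr1.
      by field; rewrite !gt_eqF.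
    rewrite -ler_pdivrMr //.
    have -> : (v - u) / (y - x) = (((v - u) / (y - x)) ^+ N.+1) `^ al.
      by rewrite -powR_mulrn // -powRrM divff ?powRr1 // pnatr_eq0.
    by apply: ge0_ler_powR; rewrite ?nnegrE ?exprn_ge0 ?(ltW eS0) ?(ltW al0).
  (* Infinite supremum: the right-hand side is 0. A nondegenerate interval inside [E] would bound
     [f] on [I] by [Ele], so there is none and [E] is null. *)
  - move=> _ _ Sle; rewrite invey mule0 poweR0r ?gt_eqF // mule0 mul0e.
    have := bound 0 (lexx 0); rewrite mulr0; apply => u v uv uvE.
    by have := Sle _ (Ele u v uv uvE).
apply: le_trans key _; apply: lee_wpmul2l => //.
by rewrite mule_ge0 ?poweR_ge0 // lee_fin mulr_ge0 ?exprn_ge0 ?powR_ge0.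
Qed.

End Goodness.

(** * Compactness on the sphere of coefficients *)

Section Coefficients.
Context {R : realType}.

(** By homogeneity [d] can be the minimum of [phi] on the unit vectors of [K], a compact set; if
    there are none, any [d] works. *)
Lemma closed_cone_coercive n (K : set 'rV[R]_n)
  (phi : 'rV[R]_n -> R) : closed K ->
  (forall a c, 0 < a -> K c -> K (a *: c)) -> continuous phi ->
  (forall a c, 0 < a -> phi (a *: c) = a * phi c) ->
  (forall c, K c -> c != 0 -> 0 < phi c) ->
  exists d, 0 < d /\ forall c, K c -> c != 0 -> d * `|c| <= phi c.
Proof.
move=> Kc Kcone phic phih phi0; pose S := K `&` [set c | `|c| = 1].
have KS c : K c -> c != 0 -> S (`|c|^-1 *: c).
  move=> Kx c0; have nc : 0 < `|c| by rewrite normr_gt0.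
  split; first by apply: Kcone; rewrite ?invr_gt0.
  by rewrite /= normrZ normfV normr_id mulVf // gt_eqF.
have [S0|/set0P S0] := eqVneq S set0.
  by exists 1; split=> // c Kx c0; have := KS c Kx c0; rewrite S0.
have Scl : closed S.
  apply: closedI => //; apply: (@preimage_closed _ R (fun c : 'rV[R]_n =>
    `|c|) [set x | x = 1]).
    by move=> c _; exact: norm_continuous.
  exact: closed_eq.
have Sb : bounded_set S.
  by exists 1; split; [exact: num_real|move=> M M1 c [_ /= ->]; exact: ltW].
have [c0] := EVT_min_rV S0 (bounded_closed_compact Sb Scl)
  (continuous_subspaceT phic).
rewrite inE => -[Kc0 nc0] cmin; exists (phi c0); split.
  by apply: phi0 => //; rewrite -normr_eq0 nc0 oner_eq0.
move=> c Kx cn0; have nc : 0 < `|c| by rewrite normr_gt0.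
have := cmin _ (mem_set (KS c Kx cn0)).
by rewrite phih ?invr_gt0 // ler_pdivlMl // mulrC.
Qed.

Lemma continuous_coord_sum n (g : 'I_n -> R) :
  continuous (fun c : 'rV[R]_n => \sum_i c 0 i * g i).
Proof.
move=> c; apply: (cvg_big add_continuous (nbhs_filter c)) => i _.
by apply: (@continuousM _ _ (fun d : 'rV[R]_n => d 0 i) (fun=> g i));
  [exact: coord_continuous|exact: cst_continuous].
Qed.

(** [c] stands for coordinates in a basis and [G c] for the coefficients along the chain. On [K] the
    selected ones vanish together only at 0, so the sum of their absolute values is coercive, while
    each coefficient is at most a constant times the norm of [c]. *)
Lemma selected_coefficients n (K : set 'rV[R]_n)
  (g : 'I_n -> nat -> R) m (P : pred nat) :
  closed K -> (forall a c, 0 < a -> K c -> K (a *: c)) ->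
  let G c j := \sum_i c 0 i * g i j in
  (forall c, K c -> c != 0 -> exists j, [/\ (j < m)%N, P j & G c j != 0]) ->
  exists k, 0 <= k /\ forall c, K c -> c != 0 -> forall j, (j < m)%N ->
    `|G c j| <= k * \sum_(l < m | P l) `|G c l|.
Proof.
move=> Kc Kcone G KP.
have [d [d0 hd]] : exists d, 0 < d /\ forall c, K c -> c != 0 ->
    d * `|c| <= \sum_(l < m | P l) `|G c l|.
  apply: closed_cone_coercive => //.
  - move=> c; apply: (cvg_big add_continuous (nbhs_filter c)) => i _.
    by apply: cvg_norm; exact: continuous_coord_sum.
  - move=> a c a0; rewrite mulr_sumr; apply: eq_bigr => j _.
    have -> : G (a *: c) j = a * G c j.
      by rewrite /G mulr_sumr; apply: eq_bigr => i _; rewrite mxE mulrA.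
    by rewrite normrM gtr0_norm.
  - move=> c Kx c0; have [j [jm Pj Gj]] := KP c Kx c0.
    apply: lt_le_trans (_ : `|G c j| <= _); first by rewrite normr_gt0.
    exact: (nth_le_sum (F := fun l => `|G c l|)).
pose M := \sum_(j < m) \sum_i `|g i j|.
have M0 : 0 <= M by apply: sumr_ge0 => j _; exact: sumr_ge0.
exists (M / d); split; first by apply: divr_ge0 => //; exact: ltW.
move=> c Kx c0 j jm; apply: le_trans (_ : M * `|c| <= _); last first.
  by rewrite -mulrA ler_wpM2l // ler_pdivlMl ?hd.
apply: le_trans (_ : (\sum_i `|g i j|) * `|c| <= _); last first.
  apply: ler_wpM2r => //.
  by apply: (nth_le_sum (F := fun j => \sum_i `|g i j|) (P := xpredT)) => // *;
    exact: sumr_ge0.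
apply: le_trans (ler_norm_sum _ _ _) _; rewrite mulr_suml;
  apply: ler_sum => i _.
rewrite normrM mulrC ler_wpM2l // [leRHS]/Num.Def.normr /= mx_normrE.
by apply/bigmax_geP; right => /=; exists (0, i).
Qed.

End Coefficients.

(** * From functions on the half-line to combinations along a chain *)

Section Assembly.
Unset Implicit Arguments.
Context {R : realType} {D : forall n : nat, set (set 'rV[R]_n)}.
Set Implicit Arguments.
Context (D_omin : o_minimal_structure D) (D_pb : polynomially_bounded D).

Lemma piecewise_monotone (es : seq (R -> R)) : every (definable1 D) es ->
  exists n (a : R), forall c (x y : R), a < x -> x <= y -> pw n (monotone_on
    (lc es c)) x y.
Proof.
move=> des; have [a1 hd] := near_is_derive_lc D_omin des.
have [n [a2 hn]] := piecewise_signed D_omin (every_der D_omin des).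
exists n, (Num.max a1 a2) => c x y; rewrite gt_max => /andP[x1 x2] xy.
rewrite -[n]addn0; apply: pw_refine (hn c x y x2 xy) => // p q xp pq qy sg.
change (monotone_on (lc es c) p q); apply: signed_monotone sg => t pt tq.
by apply: hd; exact: lt_le_trans (lt_le_trans x1 xp) pt.
Qed.

(** [definable_halfline] describes the graph over [[0, +oo[] only. As [at_real g] is even,
    substituting [|t|] defines it on the whole line. *)
Lemma definable1_at_real (g : halfline_fun R) :
  definable_halfline D g -> definable1 D (at_real g).
Proof.
move=> dg; have dN : dterm D (fun e => `|e 1%N|) by definability.
have E t : at_real g `|t| = at_real g t.
  by rewrite /at_real; congr g; apply/val_inj; rewrite /= normr_id.
have dG := dfn_D D_omin (fun i : 'I_2 => nat_of_ord i) dg.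
have dG' : dfn D (fun e => 0 <= e 0%N /\ e 1%N = at_real g (e 0%N)).
  apply: dfn_ext dG => e /=; rewrite in_itv /= andbT !mxE //=.
apply: dfn_ext (dfn_term D_omin dN (Q := fun y e =>
  0 <= y /\ e 0%N = at_real g y) _).
  by move=> e; rewrite E; split=> [[]|].
exact: dG'.
Qed.

Lemma definable1_comb (I : Type) (s : seq I) (g : I -> R -> R) (c : I -> R) :
  (forall i, definable1 D (g i)) -> definable1 D (fun t =>
    \sum_(i <- s) c i * g i t).
Proof.
move=> dg; elim: s => [|i s IH].
  by apply: dfn_ext (dterm_cst D_omin 0) => e; rewrite big_nil.
have di := dg i.
have : definable1 D (fun t => c i * g i t + \sum_(j <- s) c j * g j t) by
  definability.
by apply: dfn_ext => e; rewrite big_cons.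
Qed.

Lemma at_real_lincomb n (g : 'I_n -> halfline_fun R) (c : 'rV[R]_n) (t : R) :
  at_real (lincomb g c) t = \sum_i c 0 i * at_real (g i) t.
Proof. by rewrite /at_real /lincomb fct_sumE. Qed.

Lemma lc_sum (es : seq (R -> R)) n (c : 'rV[R]_n) (g : 'I_n -> nat -> R)
  (t : R) :
  lc es (fun j => \sum_i c 0 i * g i j) t = \sum_i c 0 i * lc es (g i) t.
Proof.
elim: es g => [|e es IH] g /=; first by rewrite big1 // => i _; rewrite mulr0.
rewrite (IH (fun i j => g i j.+1)) mulr_suml -big_split /=.
by apply: eq_bigr => i _; ring.
Qed.

Lemma lc_infinitesimal (es : seq (R -> R)) (c : nat -> R) :
  (forall j, (j < size es)%N -> infinitesimal (nth (fun=>
    0) es j) \/ c j = 0) ->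
  infinitesimal (lc es c).
Proof.
elim: es c => [|e es IH] c h /=.
  by move=> eps e0; apply: filterS (near_gt 0) => t _;
    rewrite normr0 normr1 mulr1 ltW.
have {}IH : infinitesimal (lc es (fun i => c i.+1)) by apply: IH => j;
  exact: (h j.+1).
case: (h 0%N) => // [he|c0].
  have := oo_comb (c 0%N) IH he; congr (oo _ _).
  by apply/funext => t; rewrite addrC.
suff -> : (fun t => c 0%N * e t + lc es (fun i => c i.+1) t) = lc es (fun i =>
  c i.+1) by [].
by apply/funext => t; rewrite c0 mul0r add0r.
Qed.

Lemma infinitesimal_lim (f : R -> R) : infinitesimal f ->
  lim ((f t)%:E @[t --> +oo]) = 0%E.
Proof.
move=> fs; apply/cvg_lim => //; apply: cvg_EFin; first by apply: nearW.
apply/cvgrPdist_le => eps e0; apply: filterS (fs _ e0) => t.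
by rewrite normr1 mulr1 sub0r normrN.
Qed.

End Assembly.

Unset Implicit Arguments.
Unset Strict Implicit.

Theorem theorem1p12 (R : realType) (D : forall n : nat, set (set 'rV[R]_n))
    (D_omin : o_minimal_structure D) (D_pb : polynomially_bounded D)
    (V G F : set (halfline_fun R))
    (G_def : forall g, G g -> definable_halfline D g)
    (V_span : V = linear_span G) (V_fin : finite_dimensional V)
    (FV : F `<=` V) (F_cone : cone F)
    (F_def : definable_in D V F) (F_closed : closed_in V F)
    (F_lim : forall f, F f -> f <> 0 ->
       lim ((at_real f t)%:E @[t --> +oo]) <> 0%E) :
  exists C alpha T0 : R, [/\ 0 < C, 0 < alpha, 1 <= T0 &
    forall f, F f -> f <> 0 -> good C alpha T0 f].
Proof.
have [n [b [[b_free b_span] F_cl]]] := F_closed.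
(* Definability is given for the generators in [G]; each basis vector is a combination of them. *)
have b_def i : definable1 D (at_real (b i)).
  have : V (b i).
    rewrite -b_span; exists (delta_mx 0 i) => //.
    rewrite /lincomb (bigD1 i) //= mxE !eqxx scale1r big1 ?addr0 // => j ji.
    by rewrite mxE (negbTE ji) andbF scale0r.
  rewrite V_span => -[m [g [c [gG ->]]]].
  have := definable1_comb D_omin (index_enum 'I_m) (fun j => c 0 j)
    (fun j => definable1_at_real D_omin (G_def _ (gG j))).
  by apply: dfn_ext => e; rewrite at_real_lincomb.
have [es [ch sp]] : exists es, chain (D := D) es /\ every (fun i => exists c,
    \forall t \near +oo, at_real (b i) t = lc es c t) (enum 'I_n).
  have dbs : every (definable1 D) [seq at_real (b i) | i <- enum 'I_n].
    by apply: every_map; elim: (enum 'I_n) => //= i s IH; split.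
  have [es [ch sp]] := echelon D_omin dbs; exists es; split=> //.
  by elim: (enum 'I_n) sp => //= i s IH [h /IH].
have /choice[g g_near] : forall i, exists c, \forall t \near +oo,
  at_real (b i) t = lc es c t.
  move=> i; have /(everyP _ i)/(_ (val i)) := sp.
  by rewrite size_enum_ord ltn_ord nth_ord_enum; apply.
(* Coefficients along the chain of the function with coordinates [c]: linear in [c], they describe
   the function near infinity only. *)
pose gam (c : 'rV[R]_n) j := \sum_i c 0 i * g i j.
have [a0 E] : exists a, forall c t, a < t -> at_real (lincomb b c) t = lc es
  (gam c) t.
  have : \forall t \near +oo, every (fun i =>
    at_real (b i) t = lc es (g i) t) (enum 'I_n).
    by apply: every_near; elim: (enum 'I_n) => //= i s IH; split.
  move=> /near_pinftyP[a ha]; exists a => c t /ha h.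
  rewrite at_real_lincomb /gam lc_sum; apply: eq_bigr => i _; congr (_ * _).
  have /(everyP _ i)/(_ (val i)) := h.
  by rewrite size_enum_ord ltn_ord nth_ord_enum; apply.
have F_nz c : lincomb b c <> 0 -> c != 0.
  by move=> h; apply/eqP => c0; apply: h; rewrite c0 /lincomb big1 // => i _;
    rewrite mxE scale0r.
have [K [K0 hK]] : exists k, 0 <= k /\ forall c,
  (lincomb b @^-1` F) c -> c != 0 ->
    forall j, (j < size es)%N -> `|gam c j| <=
      k * \sum_(l < size es | ~~ `[< infinitesimal (nth (fun=>
        0) es l) >]) `|gam c l|.
  apply: (selected_coefficients (P := fun j => ~~ `[< infinitesimal (nth (fun=>
    0) es j) >])) => //.
    move=> a c a0' /= Fc; have := F_cone _ _ a0' Fc;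
      rewrite /lincomb scaler_sumr.
    by congr F; apply: eq_bigr => i _; rewrite mxE scalerA.
  (* If all coefficients along the functions not tending to 0 vanished, the function would tend to
     0, which [F_lim] forbids for a nonzero element of [F]. This also rules out a nonzero element
     that vanishes near infinity. *)
  move=> c Fc c0; apply: contrapT => nj.
  have f0 : lincomb b c <> 0 by move=> /b_free /eqP; apply/negP.
  apply: (F_lim _ Fc f0); apply: infinitesimal_lim.
  have : infinitesimal (lc es (gam c)).
    apply: lc_infinitesimal => j jn; apply: contrapT => /not_orP[ni cj].
    by apply: nj; exists j; split=> //; [exact/asboolPn|exact/eqP].
  move=> h eps e0; apply: filterS2 (h _ e0) (near_gt a0) => t + ta.
  by rewrite E.
have [a1 [C [N [a10 C0 rem]]]] := global_remez D_omin D_pb ch K0.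
have [m [a2 mono]] := piecewise_monotone D_omin (chain_definable ch).
have [C' [alpha [C'0 al0 hgood]]] := good_of_remez m N (a :=
  Num.max a0 (Num.max a1 a2))
  ltac:(by rewrite !lt_max a10 orbT) C0.
(* The estimates hold strictly beyond the maximum of the thresholds, hence the final [+ 1]. *)
pose T0 := Num.max 1 (Num.max a0 (Num.max a1 a2)) + 1.
have T0a : Num.max a0 (Num.max a1 a2) < T0.
  by rewrite /T0 ltr_pwDr // le_max lexx orbT.
exists C', alpha, T0; split=> //.
  by rewrite /T0 (le_trans (_ : 1 <= Num.max 1 (Num.max a0 (Num.max a1 a2))))
    ?le_max ?lexx // lerDl.
move=> f Ff f0; have [c _ fE] : range (lincomb b) f by rewrite b_span;
  exact: FV.
rewrite -fE in Ff f0 *; have c0 := F_nz _ f0.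
apply: hgood T0a => [x y|x y u v B].
  rewrite !gt_max => /and3P[x0 x1 x2] xy.
  rewrite -[m]addn0; apply: pw_refine (mono (gam c) x y x2 xy) =>
    // p q xp pq qy mpq.
  change (monotone_on (at_real (lincomb b c)) p q).
  case: mpq => mpq; [left|right] => s t ps st tq;
    by rewrite !E ?mpq // (lt_le_trans x0) // (le_trans xp) // (le_trans ps).
rewrite !gt_max => /and3P[x0 x1 x2] xu uv vy fB t xt ty.
rewrite E; last exact: lt_le_trans xt.
apply: (rem (gam c) x y u v B) => //; first exact: hK.
move=> s us sv; rewrite -E; first exact: fB.
exact: lt_le_trans (lt_le_trans x0 xu) us.
Qed.
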